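(* Let $G$ be a primitive group of permutations of an infinite set $\Omega$ possessing no infinite subdegree. Then the canonical orbital digraphs of $G$ are equivalent, that is, any two canonical orbital digraphs of $G$ are equivalent.
   Context: Permutations act on the right. A transitive permutation group $G$ on $\Omega$ is primitive if the only $G$-invariant equivalence relations on $\Omega$ are the trivial and universal ones. The subdegrees of $G$ are the cardinalities of the orbits of the point stabilisers $G_\alpha$ on $\Omega$. A digraph $\Gamma=(V\Gamma,A\Gamma)$ has no loops and no multiple arcs; $A\Gamma$ is a set of ordered pairs of distinct vertices. Vertices $\alpha,\beta$ are adjacent if $(\alpha,\beta)$ or $(\beta,\alpha)$ lies in $A\Gamma$. All paths and connectedness are undirected. A digraph is locally finite if every vertex is adjacent to at most finitely many vertices. For $\alpha,\beta\in\Omega$, the digraph $(\Omega,(\alpha,\beta)^G)$ with vertex set $\Omega$ and arc set the orbit $(\alpha,\beta)^G$ is an orbital digraph of $G$. A half-line is a one-way infinite cycle-free (undirected) path. Two half-lines are equivalent if there are infinitely many pairwise disjoint paths connecting a vertex of one to a vertex of the other; the equivalence classes are the ends. Finite digraphs have no ends. The connectivity of an infinite connected digraph $\Gamma$ is the smallest cardinality of a set $W\subseteq V\Gamma$ such that the induced digraph $\Gamma\setminus W$ is not connected. A lobe of $\Gamma$ is a connected subgraph that is maximal subject to having connectivity strictly greater than one (that is, a block in the usual sense: a maximal connected subgraph with at least two vertices and no cut vertex of its own). A canonical orbital digraph of $G$ is a locally finite orbital digraph of $G$ with connectivity one whose lobes have at most one end. If $\Gamma$ is a locally finite connectivity-one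 orbital digraph of the primitive group $G$, in which each vertex lies in $m$ distinct lobes, and $\Lambda$ is a lobe of $\Gamma$, we write $\Gamma=\Gamma(m,\Lambda)$ (the group $G$ permutes the lobes of $\Gamma$ transitively). Two such orbital digraphs $\Gamma_1=\Gamma(m,\Lambda)$ and $\Gamma_2$ of $G$ are equivalent if $\Gamma_2=\Gamma(m,\Lambda')$ for some lobe $\Lambda'$ of $\Gamma_2$ satisfying $V\Lambda'=V\Lambda$; that is, each vertex lies in the same number $m$ of lobes in $\Gamma_1$ and in $\Gamma_2$, and some lobe of $\Gamma_2$ has the same vertex set as the lobe $\Lambda$ of $\Gamma_1$. *)

(* Defs.v *)
From mathcomp Require Import all_boot.
From mathcomp Require Import boolp classical_sets functions cardinality.

Set Implicit Arguments.
Unset Strict Implicit.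
Unset Printing Implicit Defensive.

Local Open Scope classical_set_scope.
Local Open Scope card_scope.

(* A group of permutations is a set of bijections; the image of x under g is
   written [g x], so that the product g h of the right action is [h \o g]. *)
Definition permutation_group (T : Type) (G : set (T -> T)) : Prop :=
  [/\ forall g, G g -> bijective g,
      G id,
      forall g h, G g -> G h -> G (h \o g)
    & forall g, G g -> exists h, [/\ G h, cancel g h & cancel h g]].

Definition group_orbit (T : Type) (G : set (T -> T)) (x : T) : set T :=
  [set g x | g in G].

Definition pair_orbit (T : Type) (G : set (T -> T)) (x y : T) : set (T * T) :=
  [set (g x, g y) | g in G].

Definition stabiliser (T : Type) (G : set (T -> T)) (x : T) : set (T -> T) :=
  [set g | G g /\ g x = x].

Definition transitive_group (T : Type) (G : set (T -> T)) : Prop :=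
  forall x y, group_orbit G x y.

Definition invariant_rel (T : Type) (G : set (T -> T)) (R : T -> T -> Prop) :
  Prop := forall g x y, G g -> R x y -> R (g x) (g y).

Definition primitive_group (T : Type) (G : set (T -> T)) : Prop :=
  transitive_group G /\
  forall R : T -> T -> Prop,
    RelationClasses.Equivalence R -> invariant_rel G R ->
    (forall x y, R x y <-> x = y) \/ (forall x y, R x y).

Definition no_infinite_subdegree (T : Type) (G : set (T -> T)) : Prop :=
  forall x y, finite_set (group_orbit (stabiliser G x) y).

(* The vertex set is a subset of T, so that the subgraphs of a digraph are
   again digraphs over T. *)
Record digraph (T : Type) := Digraph {
  verts : set T;
  arcs : set (T * T);
  arcs_verts : arcs `<=` verts `*` verts;
  arcs_loopless : forall x, ~ arcs (x, x)
}.

Section Digraphs.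
Variable T : Type.
Implicit Types (D L : digraph T) (W : set T) (f g : nat -> T).

Definition adjacent D (x y : T) : Prop := arcs D (x, y) \/ arcs D (y, x).

Definition locally_finite D : Prop :=
  forall x, verts D x -> finite_set [set y | adjacent D x y].

(* The path p 0, ..., p n with n edges; the values of p beyond n are irrelevant.
   Paths of length 0 are allowed. *)
Definition is_path D (n : nat) (p : nat -> T) : Prop :=
  [/\ forall i, (i <= n)%N -> verts D (p i),
      set_inj `I_n.+1 p
    & forall i, (i < n)%N -> adjacent D (p i) (p i.+1)].

Definition path_verts (n : nat) (p : nat -> T) : set T :=
  [set p i | i in `I_n.+1].

Definition connected D : Prop :=
  forall x y, verts D x -> verts D y ->
    exists n p, [/\ is_path D n p, p 0%N = x & p n = y].

Lemma delete_arcs_verts D W :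
  arcs D `&` ((verts D `\` W) `*` (verts D `\` W)) `<=`
  (verts D `\` W) `*` (verts D `\` W).
Proof. by move=> a []. Qed.

Lemma delete_arcs_loopless D W x :
  ~ (arcs D `&` ((verts D `\` W) `*` (verts D `\` W))) (x, x).
Proof. by case=> h _; exact: (arcs_loopless h). Qed.

Definition delete_verts D W : digraph T :=
  Digraph (@delete_arcs_verts D W) (@delete_arcs_loopless D W).

Definition separates D W : Prop :=
  W `<=` verts D /\ ~ connected (delete_verts D W).

Definition has_connectivity D (k : nat) : Prop :=
  [/\ infinite_set (verts D),
      connected D,
      exists W, separates D W /\ W #= `I_k
    & forall W, separates D W -> `I_k #<= W].

Definition subdigraph L D : Prop :=
  verts L `<=` verts D /\ arcs L `<=` arcs D.

Definition cut_vertex D (x : T) : Prop :=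
  verts D x /\ ~ connected (delete_verts D [set x]).

(* "Connectivity greater than one", for possibly finite digraphs: a single arc
   qualifies, a single vertex does not. *)
Definition connectivity_gt1 D : Prop :=
  [/\ exists x y, [/\ verts D x, verts D y & x <> y],
      connected D
    & forall x, ~ cut_vertex D x].

Definition lobe D L : Prop :=
  [/\ subdigraph L D,
      connectivity_gt1 L
    & forall L', subdigraph L' D -> connectivity_gt1 L' ->
        subdigraph L L' -> L' = L].

Definition half_line D f : Prop :=
  [/\ forall i, verts D (f i),
      injective f
    & forall i, adjacent D (f i) (f i.+1)].

Definition half_line_equiv D f g : Prop :=
  exists (n : nat -> nat) (p : nat -> nat -> T),
    (forall k, [/\ is_path D (n k) (p k), range f (p k 0%N)
                 & range g (p k (n k))]) /\
    trivIset [set: nat] (fun k => path_verts (n k) (p k)).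

Definition ends D : set (set (nat -> T)) :=
  [set [set g | half_line D g /\ half_line_equiv D f g] | f in half_line D].

Definition at_most_one_end D : Prop := is_subset1 (ends D).

Definition lobes_at D (x : T) : set (digraph T) :=
  [set L | lobe D L /\ verts L x].

(* D = Gamma(m, L): L is a lobe of D and each vertex of D lies in m lobes. *)
Definition is_Gamma D (m : nat) L : Prop :=
  lobe D L /\ forall x, verts D x -> lobes_at D x #= `I_m.

(* The lobe L of D1 is universally quantified, so that the relation does not
   depend on the choice of L in D1 = Gamma(m, L); the first clause says that
   D1 has at least one presentation of this form. *)
Definition equivalent_digraphs (D1 D2 : digraph T) : Prop :=
  (exists m L, is_Gamma D1 m L) /\
  forall m L, is_Gamma D1 m L ->
    exists L', is_Gamma D2 m L' /\ verts L' = verts L.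

(* Since digraphs are loopless, the pair (x, y) is necessarily off-diagonal. *)
Definition orbital_digraph (G : set (T -> T)) D : Prop :=
  verts D = [set: T] /\ exists x y, arcs D = pair_orbit G x y.

Definition canonical_orbital_digraph (G : set (T -> T)) D : Prop :=
  [/\ orbital_digraph G D,
      locally_finite D,
      has_connectivity D 1
    & forall L, lobe D L -> at_most_one_end L].

End Digraphs.

(* Main.v *)
Require Import Defs.
From mathcomp Require Import all_boot.
From mathcomp Require Import finmap.
From mathcomp Require Import boolp classical_sets functions cardinality.

(** A lobe is the digraph induced on a block, a maximal set of vertices no two
    of which are separated by a third one, so the lobes of a digraph are
    determined by the relation [coblock] of lying in a common block.  It is
    therefore enough to show that two vertices in a common block of the first
    graph lie in a common block of the second ([coblock_sub]); exchanging the
    two graphs gives the same blocks, hence lobes with the same vertex sets and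
    the same number of lobes at each vertex.

    Primitivity enters through [dichotomy]: an invariant relation that is an
    equivalence on every block either is trivial or relates any two vertices of
    a block.  Indeed the blocks are arranged in a tree, so the equivalence
    relation that it generates on all vertices adds nothing inside a block
    ([chain_local]).  It follows that the setwise stabiliser of a block is
    transitive on it ([block_setwise_transitive]) and, with more work, that the
    stabiliser of a block and of one of its points fixes no other point of the
    block ([no_fixed_point]): otherwise it would fix the whole block, and all
    vertices could be folded onto that block in a way respected by the group,
    so that the fibres of the folding would contradict primitivity.

    Suppose now that two vertices in a common block of the first graph are
    separated in the second, and let [nsep x y] be the number of vertices of
    the second graph that separate [x] from [y], themselves included.
    - It is bounded on the blocks [B] of the first graph ([nsep_bounded]).  If
      [B] is infinite, then, as it has one end and both graphs are locally
      finite, deleting a vertex [c] of the second graph leaves all but finitely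
      many points of [B] in one component.  The finite remainders are nested or
      disjoint, so an element of the stabiliser of [B] that takes one point of a
      remainder to another preserves the remainder.  As some point of it has a
      neighbour in the main part, every point [x] of it has one.  Hence [c]
      separates [x] from one of its neighbours, which leaves only boundedly
      many [c].
    - Let [D] be its maximum.  The distances in a tree satisfy the four-point
      condition ([four_point]), and since every vertex has some vertex of its
      block at distance [D], being at distance less than [D] is an equivalence
      on each block.  By [dichotomy] any two vertices of a block are at
      distance exactly [D] ([nsep_constant]).
    - So a block [B] of the first graph looks like the leaves of a star in the
      second: the cut vertex [c] nearest to [x] in the direction of another
      vertex of [B] is the same for all of them ([nearest_constant]), and it is
      fixed by the stabiliser of [x] and [B].  Back in the first graph, this
      stabiliser fixes the vertex of [B] through which [c] is reached; if that
      is [x], it fixes the first cut vertex on the way from [x] to [c], which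
      lies in another block at [x] with the same stabiliser.  Both cases are
      excluded by [no_fixed_point] ([constant_absurd]). *)

Set Implicit Arguments.
Unset Strict Implicit.
Unset Printing Implicit Defensive.

Local Open Scope classical_set_scope.
Local Open Scope card_scope.

(** * Walks inside a set of vertices *)

Section Walks.
Variables (T : Type) (e : T -> T -> Prop).
Implicit Types (A B : set T) (x y z c d : T).

(** The walk from [x] stays in [A], end points included, so that nothing is
    linked inside [A] to a vertex outside [A]. *)
Inductive linked A x : T -> Prop :=
| linked0 : A x -> linked A x x
| linkedS y z : linked A x y -> e y z -> A z -> linked A x z.

Lemma linked_l A x y : linked A x y -> A x.
Proof. by elim. Qed.

Lemma linked_r A x y : linked A x y -> A y.
Proof. by case. Qed.

Lemma linked_trans A y x z : linked A x y -> linked A y z -> linked A x z.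
Proof.
by move=> xy; elim=> // u v _ xu uv Av; apply: linkedS uv Av.
Qed.

Lemma linked1 A x y : A x -> A y -> e x y -> linked A x y.
Proof. by move=> Ax Ay xy; apply: linkedS xy Ay; exact: linked0. Qed.

Lemma linked_sub A B x y : A `<=` B -> linked A x y -> linked B x y.
Proof.
move=> AB; elim=> [/AB|u v _ xu uv /AB Bv]; first exact: linked0.
exact: linkedS uv Bv.
Qed.

(** Cut the walk at its last visit to [x]. *)
Lemma linked_first A x y : linked A x y -> x <> y ->
  exists2 z, e x z & linked (A `\` [set x]) z y.
Proof.
elim=> [|u v Axu IH uv Av] // xv.
have Dv : (A `\` [set x]) v by split=> // vx; apply: xv.
have [xu|xu] := pselect (x = u).
  by rewrite -xu in uv; exists v => //; exact: linked0.
by have [z xz zu] := IH xu; exists z => //; apply: linkedS uv Dv.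
Qed.

Lemma linked_avoid A x y d :
  linked A x y -> ~ linked A x d -> linked (A `\` [set d]) x y.
Proof.
elim=> [Ax xd|u v xu IH uv Av xd].
  by apply: linked0; split=> // h; apply: xd; rewrite -h; exact: linked0.
apply: (linkedS (IH xd) uv); split=> // vd; apply: xd; rewrite -vd.
exact: linkedS uv Av.
Qed.

(** The walk is followed until it leaves [B] for the first time. *)
Lemma linked_exit A B x y : linked A x y -> B x -> ~ B y ->
  exists u v, [/\ linked (A `&` B) x u, e u v, A v & ~ B v].
Proof.
move=> + Bx; elim=> [|u v xu IH uv Av] // nBv.
have [Bu|nBu] := pselect (B u); last exact: IH.
suff [H|[u' [v' h]]] : linked (A `&` B) x u \/
  exists u' v', [/\ linked (A `&` B) x u', e u' v', A v' & ~ B v'].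
- by exists u, v.
- by exists u', v'.
elim: xu {IH uv Bu} => [Ax|w t xw [IH|IH] wt At]; first by left; apply: linked0.
  have [Bt|nBt] := pselect (B t); last by right; exists w, t.
  by left; apply: linkedS wt _.
by right.
Qed.

Hypothesis e_sym : forall x y, e x y -> e y x.

Lemma linked_sym A x y : linked A x y -> linked A y x.
Proof.
elim=> [|u v xu ux uv Av]; first exact: linked0.
apply: linked_trans ux; apply: linked1 => //; last exact: e_sym.
exact: linked_r xu.
Qed.

End Walks.

Lemma linked_map T (e e' : T -> T -> Prop) (f : T -> T) (A B : set T) x y :
  (forall u v, e u v -> e' (f u) (f v)) -> (forall u, A u -> B (f u)) ->
  linked e A x y -> linked e' B (f x) (f y).
Proof.
move=> fe fA; elim=> [/fA|u v _ xu /fe uv /fA Bv]; first exact: linked0.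
exact: linkedS uv Bv.
Qed.

(** * Blocks of a connected graph *)

Section Blocks.
Variables (T : Type) (e : T -> T -> Prop).
Hypothesis e_sym : forall x y, e x y -> e y x.
Hypothesis e_irr : forall x, ~ e x x.
Hypothesis e_conn : forall x y, linked e setT x y.
Implicit Types (A B : set T) (x y z c d : T).

(** The component relation of the graph with [c] deleted; it is false as soon
    as [x] or [y] is [c]. *)
Definition same_side c x y := linked e [set v | v <> c] x y.

Definition coblock x y := forall c, c <> x -> c <> y -> same_side c x y.

Definition block_of x y : set T := [set z | coblock x z /\ coblock y z].

Definition block B := exists x y, [/\ x <> y, coblock x y & B = block_of x y].

Lemma same_side_sym c x y : same_side c x y -> same_side c y x.
Proof. exact: linked_sym. Qed.

Lemma same_side_trans c y x z : same_side c x y -> same_side c y z ->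
  same_side c x z.
Proof. exact: linked_trans. Qed.

Lemma same_side_refl c x : x <> c -> same_side c x x.
Proof. by move=> xc; apply: linked0. Qed.

Lemma same_side_neql c x y : same_side c x y -> x <> c.
Proof. exact: linked_l. Qed.

Lemma same_side_neqr c x y : same_side c x y -> y <> c.
Proof. exact: linked_r. Qed.

Lemma same_side_edge c x y : x <> c -> y <> c -> e x y -> same_side c x y.
Proof. by move=> xc yc xy; apply: linked1. Qed.

(** The tree-like nature of cut vertices: the component of [x] off [c], together
    with [c], is connected, and it avoids [d]. *)
Lemma same_side_exchange c d x : c <> d -> ~ same_side c x d -> same_side d x c.
Proof.
move=> cd xd.
have [->|xc] := pselect (x = c); first exact: same_side_refl.
have [z cz zx] := linked_first (e_conn c x) (nesym xc).
have {}zx : same_side c z x by apply: linked_sub zx => v -[].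
have zd : ~ same_side c z d.
  by move=> zd; apply/xd/(same_side_trans (same_side_sym zx)).
have dzx : same_side d z x by apply: linked_sub (linked_avoid zx zd) => v -[].
apply: same_side_sym; apply: (same_side_trans _ dzx).
by apply: same_side_edge => //; exact: same_side_neql dzx.
Qed.

Lemma coblock_sym x y : coblock x y -> coblock y x.
Proof. by move=> xy c cy cx; apply/same_side_sym/xy. Qed.

Lemma coblock_refl x : coblock x x.
Proof. by move=> c cx _; apply: same_side_refl; exact: nesym. Qed.

Lemma coblock_edge x y : e x y -> coblock x y.
Proof. by move=> xy c cx cy; apply: same_side_edge => //; exact: nesym. Qed.

(** A vertex [c] cannot be equal to both [x] and [y], so that [z] and [w] are
    joined off [c] through one of them. *)
Lemma coblock_glue x y z w : x <> y -> coblock x z -> coblock y z ->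
  coblock x w -> coblock y w -> coblock z w.
Proof.
move=> xy xz yz xw yw c cz cw.
have [cx|cx] := pselect (c = x).
  have cy : c <> y by rewrite cx.
  by apply: same_side_trans (same_side_sym (yz _ cy cz)) _; apply: yw.
by apply: same_side_trans (same_side_sym (xz _ cx cz)) _; apply: xw.
Qed.

Lemma block_coblock B x y : block B -> B x -> B y -> coblock x y.
Proof.
move=> [a [b [ab _ ->]]] [ax bx] [ay bY]; exact: coblock_glue ax bx ay bY.
Qed.

Lemma block_eq B x y : block B -> B x -> B y -> x <> y -> B = block_of x y.
Proof.
move=> BB Bx By xy; apply/seteqP; split=> z.
  by move=> Bz; split; apply: (block_coblock BB).
move: BB Bx By => [a [b [ab sab ->]]] [ax bx] [ay bY] [xz yz].
by split; apply: (coblock_glue xy) => //; exact: coblock_sym.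
Qed.

Lemma block_blockof x y : x <> y -> coblock x y -> block (block_of x y).
Proof. by move=> xy sxy; exists x, y. Qed.

Lemma block_of_l x y : coblock x y -> block_of x y x.
Proof. by split; [exact: coblock_refl|exact: coblock_sym]. Qed.

Lemma block_of_r x y : coblock x y -> block_of x y y.
Proof. by split; [|exact: coblock_refl]. Qed.

Lemma block_unique A B x y : block A -> block B -> A x -> A y -> B x -> B y ->
  x <> y -> A = B.
Proof.
by move=> hA hB Ax Ay Bx By xy;
  rewrite (block_eq hA Ax Ay)// (block_eq hB Bx By).
Qed.

Lemma block_other B x : block B -> exists2 y, B y & y <> x.
Proof.
move=> [a [b [ab sab ->]]].
have [ax|ax] := pselect (a = x).
  by exists b; [exact: block_of_r|move=> bx; apply: ab; rewrite ax].
by exists a => //; exact: block_of_l.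
Qed.

Lemma block_mem B x y z : block B -> B x -> B y -> x <> y ->
  coblock x z -> coblock y z -> B z.
Proof. by move=> hB Bx By xy xz yz; rewrite (block_eq hB Bx By). Qed.

Lemma vertex_ind x (Q : T -> Prop) : Q x ->
  (forall y z, Q y -> e y z -> Q z) -> forall y, Q y.
Proof.
by move=> Qx QS y; elim: (e_conn x y) => // u v _ Qu uv _; apply: QS uv.
Qed.

(** A walk from [x] to [y] that does not return to [x] stays on the side of [y],
    so its first vertex is in the block. *)
Lemma block_neighbour B x y : block B -> B x -> B y -> x <> y ->
  exists2 z, e x z & B z.
Proof.
move=> hB Bx By xy; have [z xz zy] := linked_first (e_conn x y) xy.
have {}zy : same_side x z y by apply: linked_sub zy => v -[].
exists z => //; apply: (block_mem hB Bx By xy); first exact: coblock_edge.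
apply: coblock_sym => c cz cy.
have [->//|cx] := pselect (c = x).
apply: same_side_trans (same_side_edge _ _ (e_sym xz)) _;
  [exact: nesym|exact: nesym|].
by apply: (block_coblock hB).
Qed.

(** The vertex [l] of [B] through which every walk from [z] to [B] passes. *)
Definition gate B z l :=
  B l /\ forall l', B l' -> l' <> l -> ~ same_side l z l'.

(** Moving along an edge does not change the gate, unless the edge lies in
    [B]. *)
Lemma gate_step B z w l : block B -> gate B z l -> e z w ->
  gate B w l \/ B w /\ z = l.
Proof.
move=> hB [Bl zl] zw.
have [zl'|nzl] := pselect (z = l).
  subst l; have [Bw|nBw] := pselect (B w); first by right.
  left; split=> // l' Bl' l'z wl'; apply: nBw.
  apply: (block_mem hB Bl Bl' (nesym l'z)); first exact: coblock_edge.
  apply: coblock_sym => c cw cl'; have [->//|cz] := pselect (c = z).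
  apply: same_side_trans (same_side_edge _ _ (e_sym zw)) _;
    [exact: nesym|exact: nesym|].
  by apply: (block_coblock hB).
left; split=> // l' Bl' l'l wl'; apply: (zl _ Bl' l'l).
by apply: (same_side_trans (same_side_edge _ _ zw) wl') => //;
  exact: same_side_neql wl'.
Qed.

Lemma gate_mem B z : block B -> B z -> gate B z z.
Proof. by move=> hB Bz; split=> // l' _ _ /same_side_neql. Qed.

Lemma gate_exists B z : block B -> exists l, gate B z l.
Proof.
move=> hB; have [x [y [xy sxy Bxy]]] := hB.
have Bx : B x by rewrite Bxy; exact: block_of_l.
move: z; apply: (vertex_ind (x := x)); first by exists x; exact: gate_mem.
move=> z w [l zl] /(gate_step hB zl)[wl|[Bw _]]; first by exists l.
by exists w; exact: gate_mem.
Qed.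

Lemma gate_unique B z l l' : block B -> gate B z l -> gate B z l' -> l = l'.
Proof.
move=> hB [Bl zl] [Bl' zl']; apply: contrapT => ll'.
exact/(zl' _ Bl ll')/same_side_exchange/(zl _ Bl' (nesym ll')).
Qed.

Lemma gate_inside B z l : gate B z l -> B z -> z = l.
Proof.
move=> [Bl zl] Bz; apply: contrapT => zl'; apply: (zl _ Bz zl').
exact: same_side_refl.
Qed.

(** The gate of the current vertex is followed along the walk: it moves only
    along the edges of the walk that lie in [B]. *)
Lemma linked_block A B u v : block B -> B u -> B v ->
  linked e A u v -> linked e (A `&` B) u v.
Proof.
move=> hB Bu Bv uv.
have Au := linked_l uv.
suff [l [vl ul]] : exists l, gate B v l /\ linked e (A `&` B) u l.
  by rewrite (gate_inside vl Bv).
elim: uv {Bv} => [_|z w _ [l [zl ul]] zw Aw].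
  by exists u; split; [exact: gate_mem|exact: linked0].
have [wl|[Bw zl']] := gate_step hB zl zw; first by exists l.
subst z; exists w; split; first exact: gate_mem.
by apply: linkedS zw _.
Qed.

(** The first of the vertices that separate [x] from [y], with [y] counted among
    them: it shares a block with [x]. *)
Definition nearest x y z := [/\ z <> x, coblock x z & ~ same_side z x y].

Lemma nearest_exists x y : x <> y -> exists z, nearest x y z.
Proof.
move=> xy.
suff [//|] : x = y \/ exists z, nearest x y z by [].
move: y {xy}; apply: (vertex_ind (x := x)); first by left.
move=> y w [<-|[z [zx sxz xy]]] yw.
  right; exists w; split; [|exact: coblock_edge|by move/same_side_neqr].
  by move=> wx; rewrite wx in yw; exact: e_irr yw.
have [->|xw] := pselect (x = w); [by left|right].
have [xw'|xw'] := pselect (same_side z x w); last by exists z.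
have zy : y = z.
  apply: contrapT => yz; apply: xy; apply: (same_side_trans xw');
    apply: same_side_edge => //.
    exact: same_side_neqr xw'.
  exact: e_sym.
subst y; have [sxw|] := pselect (coblock x w).
  by exists w; split=> //; [exact: nesym|by move/same_side_neqr].
move=> nsxw; exfalso; apply: nsxw => c cx cw.
have [->//|cz] := pselect (c = z).
by apply: same_side_trans (sxz c cx cz) (same_side_edge _ _ yw); exact: nesym.
Qed.

Lemma nearest_unique x y z z' : nearest x y z -> nearest x y z' -> z = z'.
Proof.
move=> [zx sxz xy] [z'x sxz' xy']; apply: contrapT => zz'.
have xz' : same_side z x z' by apply: sxz'.
have xz : same_side z' x z by apply: sxz => //; exact: nesym.
apply: xy'; apply: (same_side_trans xz); apply: same_side_sym.
apply: same_side_exchange => // yz'; apply: xy; apply: same_side_trans xz' _.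
exact: same_side_sym.
Qed.

Section Chains.
Variables (Lab : Type) (step : T * Lab -> T * Lab -> Prop).
Hypothesis step_refl : forall p, step p p.
Hypothesis step_coblock : forall p q, step p q -> coblock p.1 q.1.
Hypothesis step_local : forall p q r, step p q -> step q r ->
  coblock p.1 r.1 -> step p r.

Fixpoint chain n p r : Prop :=
  if n is m.+1 then exists2 q, step p q & chain m q r else p = r.

Lemma chain_rcons n p q r : chain n p q -> step q r -> chain n.+1 p r.
Proof.
elim: n p => [|n IH] p /=; first by move=> -> qr; exists r.
by move=> [s ps sq] qr; exists s => //; exact: IH.
Qed.

Lemma chain_last n p r : chain n.+1 p r -> exists2 q, chain n p q & step q r.
Proof.
elim: n p => [|n IH] p; first by move=> [q pq /= <-]; exists p.
by move=> [s ps /IH[q sq qr]]; exists q => //; exists s.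
Qed.

Lemma chain_cat m n p q r : chain m p q -> chain n q r -> chain (m + n) p r.
Proof.
elim: m p => [|m IH] p /=; first by move=> ->.
by move=> [s ps sq] qr; exists s => //; exact: IH.
Qed.

Lemma chain_split x n q r : q.1 <> x -> chain n q r -> same_side x q.1 r.1 \/
  exists i j s, [/\ chain i q s, chain j s r, s.1 = x & (i + j)%N = n].
Proof.
elim: n q => [|n IH] q qx; first by move=> /= <-; left; exact: same_side_refl.
move=> /= [q' qq' q'r]; have [q'x|q'x] := pselect (q'.1 = x).
  by right; exists 1%N, n, q'; split=> //; exists q'.
have [xqr|[i [j [s [h1 h2 h3 h4]]]]] := IH _ q'x q'r.
  left; apply: same_side_trans xqr; apply: (step_coblock qq'); exact: nesym.
by right; exists i.+1, j, s; split=> //; [exists q'|rewrite -h4].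
Qed.

(** Since blocks form a tree, a chain of steps between two vertices of a block
    can be shortened to a single step.  If the chain revisits its origin, it is
    cut there; otherwise its second vertex lies in a block with the origin and
    the end, because the rest of the chain avoids the origin.  A chain that
    closes up is treated in the same way after removing its last step as well.
    The labels carried along the chain show that a local rule of transport is
    free of holonomy. *)
Lemma chain_local n p r : chain n p r -> coblock p.1 r.1 -> step p r.
Proof.
move: p r; have [m] := ubnP n; elim: m n => // m IH n; rewrite ltnS => nm p r.
case: n => [|n] /= in nm *; first by move=> ->.
move=> /= [q pq qr] pr; have spq := step_coblock pq.
have [qp|qp] := pselect (q.1 = p.1).
  by apply: (step_local pq) => //; apply: IH qr _ => //; rewrite qp.
have [pr1|pr1] := pselect (p.1 = r.1); last first.
  have [pqr|[i [j [s [qs sr sp ij]]]]] := chain_split qp qr.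
    apply: (step_local pq) => //; apply: IH qr _ => // c cq cr.
    have [->//|cp] := pselect (c = p.1).
    by apply: same_side_trans (pr _ cp cr); apply/same_side_sym/spq.
  case: j => [|j] in sr ij *; first by rewrite -sr sp in pr1.
  have ps : step p s.
    apply: (IH i.+1); last by rewrite sp; exact: coblock_refl.
      by apply: leq_trans nm; rewrite -ij addnS ltnS leq_addr.
    by exists q.
  apply: (step_local ps) => //; apply: (IH j.+1); rewrite ?sp//.
  by apply: leq_trans nm; rewrite -ij ltnS leq_addl.
case: n => [|n] in nm qr *; first by rewrite /= in qr; rewrite -qr.
have [t qt tr] := chain_last qr; have str := step_coblock tr.
rewrite -pr1 in str.
have [pqt|[i [j [s [qs st sp ij]]]]] := chain_split qp qt.
  have sqt : step q t.
    apply: (IH n); [exact: ltnW| |] => // c cq ct.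
    have [->//|cp] := pselect (c = p.1).
    by apply: same_side_trans (same_side_sym (spq c cp cq)) _;
      exact: same_side_sym (str c ct cp).
  by apply: step_local (step_local pq sqt (coblock_sym str)) tr pr.
have ps : step p s.
  apply: (IH i.+1); last by rewrite sp; exact: coblock_refl.
    by apply: leq_ltn_trans nm; rewrite -ij ltnS leq_addr.
  by exists q.
apply: (step_local ps) => //; apply: (IH j.+1); last by rewrite sp.
  by apply: leq_ltn_trans nm; rewrite -ij ltnS leq_addl.
exact: chain_rcons st tr.
Qed.

End Chains.
End Blocks.

(** * Primitive groups acting on a graph with cut vertices *)

(** The undirected graph underlying an orbital digraph that has a cut vertex: an
    edge is a translate of [(a, b)] in one of its two orientations. *)
Record cut_orbital T (G : set (T -> T)) (e : T -> T -> Prop) : Prop :=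
  CutOrbital {
    co_sym : forall x y, e x y -> e y x;
    co_irr : forall x, ~ e x x;
    co_conn : forall x y, linked e setT x y;
    co_inv : forall g x y, G g -> e x y -> e (g x) (g y);
    co_arc : exists a b, e a b /\ forall x y, e x y -> exists2 g, G g &
      (x = g a /\ y = g b) \/ (y = g a /\ x = g b);
    co_cut : exists x y z, [/\ e y x, e y z & ~ same_side e y x z];
    co_fin : forall x, finite_set [set y | e x y] }.

Section PermutationGroup.
Variables (T : Type) (G : set (T -> T)).
Hypothesis G_group : permutation_group G.

Lemma group_comp g h : G g -> G h -> G (g \o h).
Proof. by case: G_group => _ _ + _ Gg Gh => /(_ h g Gh Gg). Qed.

Lemma group_id : G id.
Proof. by case: G_group. Qed.

Lemma group_inv g : G g -> exists h, [/\ G h, cancel g h & cancel h g].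
Proof. by case: G_group => _ _ _; apply. Qed.

Lemma group_inj g : G g -> injective g.
Proof. by move=> /group_inv[h [_ + _]]; exact: can_inj. Qed.

Lemma image_cancel (g h : T -> T) (B : set T) : cancel g h -> h @` (g @` B) = B.
Proof.
move=> gh; rewrite image_comp; apply/seteqP; split=> [x [y By <-]|x Bx] /=.
  by rewrite gh.
by exists x => //=; rewrite gh.
Qed.

End PermutationGroup.

Section Action.
Variables (T : Type) (G : set (T -> T)) (e : T -> T -> Prop).
Hypothesis G_group : permutation_group G.
Hypothesis G_prim : primitive_group G.
Hypothesis eG : cut_orbital G e.
Implicit Types (A B : set T) (x y z c d : T) (g h : T -> T).

Let e_sym := co_sym eG.
Let e_irr := co_irr eG.
Let e_conn := co_conn eG.
Local Notation same_side := (same_side e).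
Local Notation coblock := (coblock e).
Local Notation block := (block e).
Local Notation block_of := (block_of e).

Lemma same_side_act g c x y : G g -> same_side c x y ->
  same_side (g c) (g x) (g y).
Proof.
move=> Gg; apply: linked_map => [u v uv|u uc]; first exact: (co_inv eG).
by move=> /(group_inj G_group Gg).
Qed.

Lemma same_side_actE g c x y : G g ->
  same_side (g c) (g x) (g y) <-> same_side c x y.
Proof.
move=> Gg; split; last exact: same_side_act.
have [h [Gh gh _]] := group_inv G_group Gg.
by move=> /(same_side_act Gh); rewrite !gh.
Qed.

Lemma coblock_act g x y : G g -> coblock x y -> coblock (g x) (g y).
Proof.
move=> Gg xy c cx cy; have [h [Gh gh hg]] := group_inv G_group Gg.
rewrite -(hg c); apply: same_side_act => //; apply: xy => hc;
  [apply: cx|apply: cy].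
  by rewrite -hc hg.
by rewrite -hc hg.
Qed.

Lemma block_of_act g x y : G g -> g @` block_of x y = block_of (g x) (g y).
Proof.
move=> Gg; apply/seteqP; split=> [_ [z [xz yz] <-]|z [xz yz]].
  by split; exact: coblock_act.
have [h [Gh gh hg]] := group_inv G_group Gg.
exists (h z) => //; split.
  by rewrite -(gh x); exact: coblock_act.
by rewrite -(gh y); exact: coblock_act.
Qed.

Lemma block_act g B : G g -> block B -> block (g @` B).
Proof.
move=> Gg [x [y [xy sxy ->]]]; rewrite block_of_act//.
apply: block_blockof; last exact: coblock_act.
by move=> /(group_inj G_group Gg).
Qed.

Lemma nearest_act g x y z : G g -> nearest e x y z ->
  nearest e (g x) (g y) (g z).
Proof.
move=> Gg [zx xz zxy]; split; first by move=> /(group_inj G_group Gg).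
  exact: coblock_act.
by move=> /(same_side_actE _ _ _ Gg).
Qed.

Lemma gate_act g B z l : G g -> gate e B z l -> gate e (g @` B) (g z) (g l).
Proof.
move=> Gg [Bl zl]; split; first by exists l.
move=> _ [l' Bl' <-] ll'; rewrite same_side_actE//; apply: zl => //.
by move=> E; apply: ll'; rewrite E.
Qed.

(** By [chain_local] the equivalence relation generated by [R] restricts to [R]
    on each block; it is invariant, hence trivial or universal. *)
Lemma dichotomy (R : T -> T -> Prop) :
  (forall x, R x x) -> (forall x y, R x y -> R y x) ->
  (forall x y, R x y -> coblock x y) ->
  (forall x y z, R x y -> R y z -> coblock x z -> R x z) ->
  invariant_rel G R ->
  (forall x y, R x y -> x = y) \/ (forall x y, coblock x y -> R x y).
Proof.
move=> Rxx Rsym Rco Rloc Rinv.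
pose step (p q : T * unit) := R p.1 q.1.
pose E x y := exists n, chain step n (x, tt) (y, tt).
have ER x y : coblock x y -> E x y -> R x y.
  move=> xy [n c]; apply: (@chain_local _ _ e_sym _ step _ _ _ _ _ _ c xy).
  - by move=> p; exact: Rxx.
  - by move=> p q; exact: Rco.
  - by move=> p q r; exact: Rloc.
have EE : RelationClasses.Equivalence E.
  split=> [x|x y [n]|x y z [n xy] [m yz]]; first by exists 0%N.
    elim: n x => [|n IH] x; first by move=> -[<-]; exists 0%N.
    move=> [[q []] xq /IH[m qy]]; exists m.+1; apply: chain_rcons qy _.
    exact: Rsym.
  by exists (n + m)%N; apply: chain_cat xy yz.
have EG : invariant_rel G E.
  move=> g x y Gg [n]; elim: n x => [|n IH] x; first by move=> -[<-];
    exists 0%N.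
  move=> [[q []] xq /IH[m qy]]; exists m.+1; exists (g q, tt) => //.
  exact: Rinv.
have [Etriv|Etot] := G_prim.2 E EE EG; [left|right].
  move=> x y xy; apply/Etriv; exists 1%N; exists (y, tt) => //.
by move=> x y xy; exact: ER.
Qed.

(** Say that two vertices are equivalent when some chain joins them and returns
    to the label it started from.  This relation is invariant; it is not
    universal, since by [chain_local] it is trivial on blocks, and two steps as
    in the conclusion would make it nontrivial.  The group acts on the vertices
    only, and the maps [s] make the starting label irrelevant. *)
Lemma no_labelling Lab (step : T * Lab -> T * Lab -> Prop) :
  (forall p, step p p) -> (forall p q, step p q -> step q p) ->
  (forall p q, step p q -> coblock p.1 q.1) ->
  (forall p q r, step p q -> step q r -> coblock p.1 r.1 -> step p r) ->
  (forall g p q, G g -> step p q -> step (g p.1, p.2) (g q.1, q.2)) ->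
  (forall a b, exists s, s a = b /\
    forall p q, step p q -> step (p.1, s p.2) (q.1, s q.2)) ->
  (forall x y a, step (x, a) (y, a) -> x = y) ->
  ~ exists x y z a b, [/\ x <> z, step (x, a) (y, b) & step (y, b) (z, a)].
Proof.
move=> srefl ssym sco sloc sG shom sinj [x [y [z [a [b [xz xy yz]]]]]].
pose E x y := exists a n, chain step n (x, a) (y, a).
have EE : RelationClasses.Equivalence E.
  split=> [u|u v [c [n uv]]|u v w [c [n uv]] [d [m vw]]].
  - by exists a, 0%N.
  - exists c; move: uv; move: (u, c) (v, c) => p q.
    elim: n p => [|n IH] p; first by move=> <-; exists 0%N.
    move=> [r pr /IH[m qr]]; exists m.+1; apply: chain_rcons qr _.
    exact: ssym.
  have [s [scd sP]] := shom c d; subst d.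
  exists (s c); exists (n + m)%N; apply: (chain_cat _ vw).
  change (chain step n ((u, c).1, s (u, c).2) ((v, c).1, s (v, c).2)).
  elim: n (u, c) (v, c) uv => [|n IH] p q; first by move=> <-.
  by move=> [r pr rq]; exists (r.1, s r.2); [exact: sP|exact: IH].
have EG : invariant_rel G E.
  move=> g u v Gg [c [n uv]]; exists c, n.
  change (chain step n (g (u, c).1, (u, c).2) (g (v, c).1, (v, c).2)).
  elim: n (u, c) (v, c) uv => [|n IH] p q; first by move=> <-.
  by move=> [r pr rq]; exists (g r.1, r.2); [exact: sG|exact: IH].
have [Etriv|Etot] := G_prim.2 E EE EG.
  apply: xz; apply/Etriv; exists a, 2%N; exists (y, b) => //.
  by exists (z, a).
have [u [v [w [/= vu _ _]]]] := co_cut eG.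
have [c [n uv]] := Etot u v.
have suv : coblock u v by apply: coblock_edge; exact: e_sym.
have := sinj u v c (chain_local e_sym srefl sco sloc uv suv).
by move=> E0; rewrite E0 in vu; exact: e_irr vu.
Qed.

Lemma block_edge B : block B -> exists x y, [/\ e x y, B x & B y].
Proof.
move=> hB; have [x [y [xy sxy Bxy]]] := hB.
have Bx : B x by rewrite Bxy; exact: block_of_l.
have By : B y by rewrite Bxy; exact: block_of_r.
by have [z xz Bz] := block_neighbour e_sym e_conn hB Bx By xy; exists x, z.
Qed.

Lemma edge_neq x y : e x y -> x <> y.
Proof. by move=> xy E; rewrite E in xy; exact: e_irr xy. Qed.

Lemma block_act_eq g A B x y : G g -> block A -> block B -> A x -> A y ->
  x <> y -> B (g x) -> B (g y) -> g @` A = B.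
Proof.
move=> Gg hA hB Ax Ay xy Bx By.
apply: (block_unique e_sym (block_act Gg hA) hB _ _ Bx By).
- by exists x.
- by exists y.
- by move=> /(group_inj G_group Gg).
Qed.

Lemma block_trans A B : block A -> block B -> exists2 g, G g & g @` A = B.
Proof.
have [a [b [ab abP]]] := co_arc eG.
have hab : block (block_of a b).
  by apply: block_blockof; [exact: edge_neq|exact: coblock_edge].
have abB C : block C -> exists2 g, G g & g @` block_of a b = C.
  move=> hC; have [x [y [xy Cx Cy]]] := block_edge hC.
  have [g Gg gxy] := abP _ _ xy; exists g => //.
  have sab := coblock_edge ab.
  apply: (@block_act_eq g _ _ a b) => //.
  - exact: block_of_l.
  - exact: block_of_r.
  - exact: edge_neq.
  - by case: gxy => -[E1 E2]; rewrite -?E1 -?E2.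
  - by case: gxy => -[E1 E2]; rewrite -?E1 -?E2.
move=> /abB[g Gg <-] /abB[k Gk <-].
have [h [Gh gh hg]] := group_inv G_group Gg.
exists (k \o h); first exact: (group_comp G_group).
by rewrite -image_comp (image_cancel _ gh).
Qed.

(** By [dichotomy], the orbits of the block stabilisers are the whole blocks
    unless these stabilisers act trivially.  In that case, as there is only one
    orbit of edges up to orientation, every block is a single edge and the graph
    is a tree; the parity of the distance then gives an invariant equivalence
    relation, which is excluded by [no_labelling]. *)
Lemma block_setwise_transitive B x y : block B -> B x -> B y ->
  exists g, [/\ G g, g @` B = B & g x = y].
Proof.
pose R x y := x = y \/ exists B g,
  [/\ block B, B x, B y & [/\ G g, g @` B = B & g x = y]].
have [|||||Rtriv|Rtot] := @dichotomy R.
- by left.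
- move=> u v [->|[C [g [hC Cu Cv [Gg gC gu]]]]]; [by left|right].
  have [h [Gh gh hg]] := group_inv G_group Gg.
  exists C, h; split=> //; split=> //; last by rewrite -gu.
  by rewrite -{1}gC image_cancel.
- move=> u v [->|[C [g [hC Cu Cv _]]]]; first exact: coblock_refl.
  exact: (block_coblock e_sym hC).
- move=> u v w [->//|[C [g [hC Cu Cv [Gg gC gu]]]]].
  move=> [<-|[D [h [hD Dv Dw [Gh hhD hv]]]]] suw.
    by right; exists C, g.
  have [->|uw] := pselect (u = w); [by left|right].
  have [uv|uv] := pselect (u = v).
    by exists D, h; split=> //; rewrite uv.
  have [vw|vw] := pselect (v = w).
    by exists C, g; split=> //; rewrite -vw.
  have Cw : C w.
    apply: (block_mem e_sym hC Cu Cv uv suw).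
    exact: (block_coblock e_sym hD).
  have CD : C = D by apply: (block_unique e_sym hC hD Cv Cw Dv Dw vw).
  subst D; exists C, (h \o g); split=> //; split.
  - exact: (group_comp G_group).
  - by rewrite -image_comp gC.
  - by rewrite /= gu.
- move=> g u v Gg [->|[C [k [hC Cu Cv [Gk kC ku]]]]]; [by left|right].
  have [h [Gh gh hg]] := group_inv G_group Gg.
  exists (g @` C), (g \o k \o h); split;
    [exact: block_act|by exists u|by exists v|].
  split; first by apply: (group_comp G_group) => //;
    exact: (group_comp G_group).
    by rewrite -image_comp (image_cancel _ gh) -image_comp kC.
  by rewrite /= gh ku.
- exfalso.
  (* The block stabilisers act trivially: every block is a single edge. *)
  have [a [b [ab abP]]] := co_arc eG.
  have fixB C g u : block C -> G g -> g @` C = C -> C u -> g u = u.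
    move=> hC Gg gC Cu; apply/esym/Rtriv; right; exists C, g; split=> //.
    by rewrite -gC; exists u.
  have sab := coblock_edge ab.
  have hab : block (block_of a b) by apply: block_blockof => //;
    exact: edge_neq.
  have two u : block_of a b u -> u = a \/ u = b.
    move=> Bu; have [w Bw wu] := block_other e_sym u hab.
    have [v uv Bv] := block_neighbour e_sym e_conn hab Bu Bw (nesym wu).
    have [g Gg gab] := abP _ _ uv.
    have gB : g @` block_of a b = block_of a b.
      apply: (@block_act_eq g _ _ a b) => //.
      - exact: block_of_l.
      - exact: block_of_r.
      - exact: edge_neq.
      - by case: gab => -[E1 E2]; rewrite -?E1 -?E2.
      - by case: gab => -[E1 E2]; rewrite -?E1 -?E2.
    have ga := fixB _ _ _ hab Gg gB (block_of_l e_sym sab).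
    have gb := fixB _ _ _ hab Gg gB (block_of_r sab).
    by case: gab => -[E1 E2]; rewrite ?E1 ?E2 ?ga ?gb; auto.
  have three C u v w : block C -> C u -> C v -> C w -> u <> v ->
      v <> w -> u = w.
    move=> hC Cu Cv Cw.
    have [g Gg gC] := block_trans hC hab.
    have Cab t : C t -> g t = a \/ g t = b.
      by move=> Ct; apply: two; rewrite -gC; exists t.
    have ginj := group_inj G_group Gg.
    case: (Cab _ Cu) (Cab _ Cv) (Cab _ Cw) => gu [] gv [] gw uv vw;
      solve [ by case: uv; apply: ginj; rewrite gu gv
            | by case: vw; apply: ginj; rewrite gv gw
            | by apply: ginj; rewrite gu gw ].
  (* The labels record the parity of the distance. *)
  pose step (p q : T * bool) := coblock p.1 q.1 /\ (p.1 = q.1 <-> p.2 = q.2).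
  apply: (@no_labelling _ step).
  + by move=> p; split=> //; exact: coblock_refl.
  + by move=> p q [pq E]; split; [exact: coblock_sym|split=> /esym/E].
  + by move=> p q [].
  + move=> [p a1] [q a2] [r a3] [/= pq E1] [/= qr E2] pr; split=> //=.
    have [pq'|pq'] := pselect (p = q).
      by have -> := E1.1 pq'; rewrite pq'.
    have [qr'|qr'] := pselect (q = r).
      by have <- := E2.1 qr'; rewrite -qr'.
    have hC := block_blockof pq' pq.
    have Cr : block_of p q r by split.
    have <- : p = r.
      exact: (three _ _ _ _ hC (block_of_l e_sym pq) (block_of_r pq) Cr pq'
        qr').
    have [n12 n23] : a1 <> a2 /\ a2 <> a3 by split=> [/E1.2|/E2.2].
    by split=> // _; case: a1 a2 a3 {E1 E2} n12 n23 => [] [] [].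
  + move=> g p q Gg [pq E]; split; first exact: coblock_act.
    split=> /=; first by move=> /(group_inj G_group Gg)/E.
    by move=> /E ->.
  + move=> c d; exists (fun t => t (+) (c (+) d)); split.
      by case: c d => [] [].
    move=> p q [pq E]; split=> //=; split=> [/E-> //|].
    by move=> /addIb/E.
  + by move=> x1 y1 c [_ /= [_ ->]].
  have [u [v [w [vu vw nuw]]]] := co_cut eG.
  exists u, v, w, true, false; split.
  + move=> uw; apply: nuw; rewrite -uw; apply: same_side_refl.
    exact/nesym/edge_neq.
  + split=> /=; first exact/coblock_edge/e_sym.
    by split=> // uv; rewrite uv in vu; case: (e_irr vu).
  + split=> /=; first exact/coblock_edge.
    by split=> // vw'; rewrite vw' in vw; case: (e_irr vw).
- move=> hB Bx By.
  have [xy|xy] := pselect (x = y).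
    by exists id; split=> //; [exact: (group_id G_group)|rewrite image_id].
  have [//|[C [g [hC Cx Cy gP]]]] := Rtot x y (block_coblock e_sym hB Bx By).
  by exists g; rewrite (block_unique e_sym hB hC Bx By).
Qed.

(** Were [z] fixed, transporting [(x, B, z)] by the group would select in each
    block, for each of its points, another point.  Applying [dichotomy] first to
    the equality of selected points and then to the equality of stabilisers
    shows that the stabiliser of a block and of one of its points fixes the
    block pointwise.
    Each block then has exactly one translation to [B] with a given value at a
    given point, and labelling vertices by points of [B] accordingly is
    consistent. *)
Lemma no_fixed_point B x z : block B -> B x -> B z -> z <> x ->
  ~ forall g, G g -> g @` B = B -> g x = x -> g z = z.
Proof.
move=> hB Bx Bz zx fixz.
pose P u C w := exists2 g, G g & [/\ g x = u, g @` B = C & g z = w].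
have Pfun u C w w' : P u C w -> P u C w' -> w = w'.
  move=> [g Gg [gx gB gz]] [k Gk [kx kB kz]].
  have [h [Gh gh hg]] := group_inv G_group Gg.
  have : (h \o k) z = z.
    apply: fixz; first exact: (group_comp G_group).
      by rewrite -image_comp kB -gB (image_cancel _ gh).
    by rewrite /= kx -gx gh.
  by move=> /(congr1 g); rewrite /= hg gz kz.
have Ptot u C : block C -> C u -> exists w, P u C w.
  move=> hC Cu; have [g Gg gB] := block_trans hB hC.
  have Cgx : C (g x) by rewrite -gB; exists x.
  have [h [Gh hC' hgx]] := block_setwise_transitive hC Cgx Cu.
  exists (h (g z)), (h \o g); first exact: (group_comp G_group).
  by split=> //; rewrite -image_comp gB.
have Pneq u C w : P u C w -> w <> u.
  by move=> [g Gg [<- _ <-]] /(group_inj G_group Gg).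
have Pin u C w : P u C w -> C w by move=> [g Gg [_ <- <-]]; exists z.
have Pact g u C w : G g -> P u C w -> P (g u) (g @` C) (g w).
  move=> Gg [k Gk [<- <- <-]]; exists (g \o k);
    first exact: (group_comp G_group).
  by split=> //; rewrite -image_comp.
have PB : P x B z.
  by exists id; [exact: (group_id G_group)|rewrite image_id].
(* The selection is one-to-one: were all selected points of a block equal, the
   common point would be selected for itself. *)
have inj C u v w : block C -> C u -> C v -> P u C w -> P v C w -> u = v.
  pose R u v := u = v \/
    exists C w, [/\ block C, C u, C v & P u C w /\ P v C w].
  have [|||||Rtriv|Rtot] := @dichotomy R.
  - by left.
  - by move=> a b [->|[D [t [? ? ? []]]]]; [left|right; exists D, t].
  - move=> a b [->|[D [t [hD Da Db _]]]]; first exact: coblock_refl.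
    exact: (block_coblock e_sym hD).
  - move=> a b c [->//|[D [t [hD Da Db [Pa Pb]]]]].
    move=> [<-|[D' [t' [hD' Db' Dc' [Pb' Pc']]]]] sac.
      by right; exists D, t.
    have [->|ac] := pselect (a = c); [by left|right].
    have [ab|ab] := pselect (a = b).
      by exists D', t'; split=> //; rewrite ab.
    have [bc|bc] := pselect (b = c).
      by exists D, t; split=> //; rewrite -bc.
    have Dc : D c.
      apply: (block_mem e_sym hD Da Db ab sac).
      exact: (block_coblock e_sym hD').
    have DD' : D = D' by apply: (block_unique e_sym hD hD' Db Dc Db' Dc' bc).
    subst D'; exists D, t; split=> //; split=> //.
    by rewrite (Pfun _ _ _ _ Pb Pb').
  - move=> g a b Gg [->|[D [t [hD Da Db [Pa Pb]]]]]; [by left|right].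
    exists (g @` D), (g t); split; [exact: block_act|by exists a|by exists b|].
    by split; exact: Pact.
  - by move=> hC Cu Cv Pu Pv; apply: Rtriv; right; exists C, w.
  - exfalso; have [E|[C' [t [hC Cx Cz [Px Pz]]]]] := Rtot x z (block_coblock
    e_sym hB Bx Bz).
      by apply: zx.
    have E : B = C' by apply: (block_unique e_sym hB hC Bx Bz Cx Cz (nesym zx)).
    subst C'; have E := Pfun _ _ _ _ PB Px; subst t.
    by apply: Pneq Pz _.
(* If g moves x, it also moves z, because the selection is one-to-one; so the
   stabilisers of x and z in B coincide, and the relation is not trivial. *)
have reg C u v g : block C -> C u -> C v -> G g -> g @` C = C ->
    g u = u -> g v = v.
  pose R u v := u = v \/ exists C, [/\ block C, C u, C v &
    forall g, G g -> g @` C = C -> g u = u <-> g v = v].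
  have [|||||Rtriv|Rtot] := @dichotomy R.
  - by left.
  - move=> a b [->|[D [? ? ? E]]]; [by left|right; exists D; split=> //].
    by move=> k Gk kD; split=> /(E k Gk kD).
  - move=> a b [->|[D [hD Da Db _]]]; first exact: coblock_refl.
    exact: (block_coblock e_sym hD).
  - move=> a b c [->//|[D [hD Da Db E]]].
    move=> [<-|[D' [hD' Db' Dc' E']]] sac.
      by right; exists D.
    have [->|ac] := pselect (a = c); [by left|right].
    have [ab|ab] := pselect (a = b).
      by exists D'; rewrite ab.
    have [bc|bc] := pselect (b = c).
      by exists D; rewrite -bc.
    have Dc : D c.
      apply: (block_mem e_sym hD Da Db ab sac).
      exact: (block_coblock e_sym hD').
    have DD' : D = D' by apply: (block_unique e_sym hD hD' Db Dc Db' Dc' bc).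
    subst D'; exists D; split=> // k Gk kD.
    by split=> [/(E k Gk kD)/(E' k Gk kD)|/(E' k Gk kD)/(E k Gk kD)].
  - move=> k a b Gk [->|[D [hD Da Db E]]]; [by left|right].
    have [h [Gh kh hk]] := group_inv G_group Gk.
    exists (k @` D); split; [exact: block_act|by exists a|by exists b|].
    move=> f Gf fD.
    have conjE c : f (k c) = k c <-> (h \o f \o k) c = c.
      by rewrite /=; split=> [->|/(congr1 k)]; rewrite ?kh// hk.
    rewrite !conjE; apply: E.
      by apply: (group_comp G_group) => //; exact: (group_comp G_group).
    by rewrite -image_comp -image_comp fD (image_cancel _ kh).
  - exfalso; apply: zx; apply/esym/Rtriv; right; exists B; split=> // k Gk kB.
    split=> [|kz]; first exact: fixz.
    have Pk : P (k x) B z by rewrite -{1}kB -{1}kz; exact: Pact.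
    by apply: (inj B _ _ z) => //; exact: Pin Pk || by rewrite -kB; exists x.
  - move=> hC Cu Cv Gg gC gu.
    have [<-//|[C' [hC' Cu' Cv' E]]] := Rtot u v (block_coblock e_sym hC Cu Cv).
    have [<-//|uv] := pselect (u = v).
    apply/(E g Gg) => //.
    by rewrite -(block_unique e_sym hC hC' Cu Cv Cu' Cv' uv).
(* Labels are points of B: a translation of a block onto B is determined by its
   value at one point, by [reg], and it prescribes the labels of the block. *)
pose step (p q : T * {l : T | B l}) := coblock p.1 q.1 /\
  exists2 g, G g & g p.1 = sval p.2 /\ g q.1 = sval q.2.
have sval_inj (l l' : {l : T | B l}) : sval l = sval l' -> l = l'.
  by case: l l' => [l Bl] [l' Bl'] /= E; subst l'; congr exist;
    exact: Prop_irrelevance.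
apply: (@no_labelling _ step).
- move=> p; split; first exact: coblock_refl.
  by have [g Gg gp] := G_prim.1 p.1 (sval p.2); exists g.
- by move=> p q [pq [g Gg []]]; split; [exact: coblock_sym|exists g].
- by move=> p q [].
- move=> [a [la Ba]] [b [lb Bb]] [c [lc Bc]] [/= ab [g Gg [ga gb]]].
  move=> [/= bc [k Gk [kb kc]]] ac; split=> //=.
  have [E|nab] := pselect (a = b).
    by exists k => //; rewrite E kb -gb -E.
  have [E|nbc] := pselect (b = c).
    by exists g => //; rewrite -E gb -kb E.
  have hC := block_blockof nbc bc.
  have Cb := block_of_l e_sym bc; have Cc := block_of_r bc.
  have Ca : block_of b c a by split; exact: coblock_sym.
  have gC : g @` block_of b c = B.
    by apply: (block_act_eq Gg hC hB Ca Cb nab); rewrite ?ga ?gb.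
  have kC : k @` block_of b c = B.
    by apply: (block_act_eq Gk hC hB Cb Cc nbc); rewrite ?kb ?kc.
  have [h [Gh gh hg]] := group_inv G_group Gg.
  exists k => //; split=> //.
  have <- : (k \o h) la = la.
    apply: (reg B lb la) => //; first exact: (group_comp G_group).
      by rewrite -image_comp -{1}gC (image_cancel _ gh).
    by rewrite /= -{1}gb gh.
  by rewrite /= -ga gh.
- move=> f p q Gf [pq [g Gg [gp gq]]]; split; first exact: coblock_act.
  have [h [Gh fh hf]] := group_inv G_group Gf.
  exists (g \o h); first exact: (group_comp G_group).
  by rewrite /= !fh.
- move=> [a Ba] [b Bb].
  have [f [Gf fB fa]] := block_setwise_transitive hB Ba Bb.
  have Bf l : B l -> B (f l) by move=> Bl; rewrite -fB; exists l.
  exists (fun l => exist B (f (sval l)) (Bf _ (svalP l))); split.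
    exact: sval_inj.
  move=> p q [pq [g Gg [gp gq]]]; split=> //.
  exists (f \o g); first exact: (group_comp G_group).
  by rewrite /= gp gq.
- move=> u v [l Bl] [_ [g Gg [/= gu gv]]].
  by apply: (group_inj G_group Gg); rewrite gu gv.
(* Two blocks at v: a point u of the first and a point t of the second carry
   the same label. *)
have [u [v [w [vu vw nuw]]]] := co_cut eG.
have svu := coblock_edge vu; have svw := coblock_edge vw.
have nvu := edge_neq vu; have nvw := edge_neq vw.
have [g Gg gB] := block_trans (block_blockof nvu svu) hB.
have Bgv : B (g v) by rewrite -gB; exists v => //; exact: block_of_l.
have Bgu : B (g u) by rewrite -gB; exists u => //; exact: block_of_r.
have hC := block_blockof nvw svw.
have [k0 Gk0 k0B] := block_trans hC hB.
have Bkv : B (k0 v) by rewrite -k0B; exists v => //; exact: block_of_l.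
have [k1 [Gk1 k1B k1v]] := block_setwise_transitive hB Bkv Bgv.
pose k := k1 \o k0; have Gk : G k by exact: (group_comp G_group).
have kB : k @` block_of v w = B by rewrite /k -image_comp k0B.
have [t Ct kt] : (k @` block_of v w) (g u) by rewrite kB.
exists u, v, t, (exist B _ Bgu), (exist B _ Bgv); split.
- move=> ut; subst t; apply: nuw.
  by apply: (block_coblock e_sym hC Ct (block_of_r svw)).
- by split; [exact: coblock_sym|exists g].
- by split; [case: Ct|exists k].
Qed.

(** A block at [x] is determined by any neighbour of [x] in it. *)
Lemma finite_blocks x : finite_set [set B | block B /\ B x].
Proof.
apply: sub_finite_set (finite_image (block_of x) (co_fin eG x)).
move=> B [hB Bx]; have [y By yx] := block_other e_sym x hB.
have [z xz Bz] := block_neighbour e_sym e_conn hB Bx By (nesym yx).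
by exists z => //; rewrite (block_eq e_sym hB Bx Bz)//; exact: edge_neq.
Qed.

(** The group fixing [x] is transitive on the finite set of blocks at [x], so an
    inclusion between two of the stabilisers there is an equality: the map that
    sends each translate of [A] to the same translate of [B] is onto, hence
    one-to-one. *)
Lemma stabiliser_inclusion_sym x A B : block A -> block B -> A x -> B x ->
  (forall g, G g -> g x = x -> g @` A = A -> g @` B = B) ->
  forall g, G g -> g x = x -> g @` B = B -> g @` A = A.
Proof.
move=> hA hB Ax Bx AB.
pose U := [set C | block C /\ C x].
have moveA C : U C -> exists g, [/\ G g, g x = x & g @` A = C].
  move=> [hC Cx]; have [g Gg gA] := block_trans hA hC.
  have Cgx : C (g x) by rewrite -gA; exists x.
  have [h [Gh hhC hgx]] := block_setwise_transitive hC Cgx Cx.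
  exists (h \o g); split=> //; first exact: (group_comp G_group).
  by rewrite -image_comp gA.
have moveB C : U C -> exists g, [/\ G g, g x = x & g @` B = C].
  move=> [hC Cx]; have [g Gg gA] := block_trans hB hC.
  have Cgx : C (g x) by rewrite -gA; exists x.
  have [h [Gh hhC hgx]] := block_setwise_transitive hC Cgx Cx.
  exists (h \o g); split=> //; first exact: (group_comp G_group).
  by rewrite -image_comp gA.
pose f (C : {classic set T}) : {classic set T} :=
  if pselect (U C) is left UC then sval (cid (moveA C UC)) @` B else C.
have fE g : G g -> g x = x -> f (g @` A) = g @` B.
  move=> Gg gx; rewrite /f; case: pselect => [UC|[]]; last first.
    by split; [exact: block_act|exists x].
  case: cid => k /= [Gk kx kA].
  have [h [Gh gh hg]] := group_inv G_group Gg.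
  have hk : (h \o k) @` B = B.
    apply: AB; first exact: (group_comp G_group).
      by rewrite /= kx -{1}gx gh.
    by rewrite -image_comp kA (image_cancel _ gh).
  by rewrite -{2}hk -image_comp (image_cancel _ hg).
have [s0 s0U] := (@finite_seqP {classic set T} U).1 (finite_blocks x).
pose s := undup s0.
have sU C : (C \in s) <-> U C by rewrite mem_undup s0U.
have s_map : {subset s <= map f s}.
  move=> C /sU/moveB[g [Gg gx <-]]; rewrite -fE//; apply: map_f; apply/sU.
  by split; [exact: block_act|exists x].
have f_uniq : uniq (map f s).
  by apply: (leq_size_uniq (undup_uniq s0) s_map); rewrite size_map.
move=> g Gg gx gB.
have sA : (A : {classic set T}) \in s by apply/sU.
have sgA : (g @` A : {classic set T}) \in s.
  by apply/sU; split; [exact: block_act|exists x].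
have fA : f A = B.
  by have := fE id (group_id G_group) (erefl x); rewrite !image_id.
have fgA : f (g @` A) = f A by rewrite fA fE.
have iA : (index (A : {classic set T}) s < size s)%N by rewrite index_mem.
have igA : (index (g @` A : {classic set T}) s < size s)%N by rewrite index_mem.
suff E : index (g @` A : {classic set T}) s = index (A : {classic set T}) s.
  by have := nth_index A sgA; rewrite E nth_index.
apply/eqP; rewrite -(nth_uniq (f A) _ _ f_uniq) ?size_map//.
by rewrite !(nth_map A)// !nth_index// fgA.
Qed.

End Action.

(** * Walks and paths in digraphs *)

Section Paths.
Variable T : Type.
Implicit Types (D : digraph T) (A W : set T).

Lemma adjacent_sym D x y : adjacent D x y -> adjacent D y x.
Proof. by case; [right|left]. Qed.

Lemma adjacent_irr D x : ~ adjacent D x x.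
Proof. by case=> /(@arcs_loopless _ D). Qed.

Lemma adjacent_verts D x y : adjacent D x y -> verts D x /\ verts D y.
Proof. by case=> /(@arcs_verts _ D)[]. Qed.

Lemma path_linked D n p : is_path D n p ->
  forall i, (i <= n)%N -> linked (adjacent D) (verts D) (p 0%N) (p i).
Proof.
move=> [pV _ pe]; elim=> [|i IH] lin; first by apply: linked0; exact: pV.
by apply: linkedS (pe _ lin) (pV _ lin); apply: IH; exact: ltnW.
Qed.

Lemma linked_path D x y : linked (adjacent D) (verts D) x y ->
  exists n p, [/\ is_path D n p, p 0%N = x & p n = y].
Proof.
elim=> [Vx|u v _ [n [p [[pV pinj pe] p0 pn]]] uv Vv].
  by exists 0%N, (fun _ => x); split=> //; split=> // i j;
    rewrite !inE /= !ltnS !leqn0 => /eqP-> /eqP->.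
have [[i [lein piv]]|nv] := pselect (exists i, (i <= n)%N /\ p i = v).
  exists i, p; split=> //; split=> [j ji|j k|j ji].
  - by apply: pV; exact: leq_trans lein.
  - rewrite !inE /= !ltnS => ji ki; apply: pinj; rewrite inE /= ltnS.
      exact: leq_trans lein.
    exact: leq_trans lein.
  - by apply: pe; exact: leq_trans lein.
exists n.+1, (fun j => if (j <= n)%N then p j else v); split=> //;
  last by rewrite ltnn.
split=> [i _|i j|i].
- by case: ifP => // /pV.
- rewrite !inE /= !ltnS => ilt jlt; case: ifP => li; case: ifP => lj.
  + by apply: pinj; rewrite inE /= ltnS.
  + by move=> piv; case: nv; exists i.
  + by move=> /esym piv; case: nv; exists j.
  + move=> _; move: ilt jlt; rewrite leq_eqVlt ltnS li orbF leq_eqVlt ltnS lj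
    orbF.
    by move=> /eqP-> /eqP->.
- rewrite ltnS => lin; rewrite lin; case: ifP => li; first exact: pe.
  have -> : i = n by apply/eqP; rewrite eqn_leq lin leqNgt li.
  by rewrite pn.
Qed.

Lemma connectedP D : connected D <->
  forall x y, verts D x -> verts D y -> linked (adjacent D) (verts D) x y.
Proof.
split=> DC x y Vx Vy; last by apply: linked_path; exact: DC.
by have [n [p [pP <- <-]]] := DC x y Vx Vy; apply: (path_linked pP).
Qed.

Lemma adjacent_delete D W x y : adjacent (delete_verts D W) x y <->
  [/\ adjacent D x y, ~ W x & ~ W y].
Proof.
split=> [[[xy [[? ?] [? ?]]]|[xy [[? ?] [? ?]]]]|[xy nx ny]].
- by split=> //; left.
- by split=> //; right.
by have [Vx Vy] := adjacent_verts xy; case: xy => xy; [left|right].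
Qed.

Lemma linked_delete D W x y :
  linked (adjacent (delete_verts D W)) (verts (delete_verts D W)) x y <->
  linked (adjacent D) (verts D `\` W) x y.
Proof.
split; elim=> [Vx|u v _ uv' uv Vv]; try exact: linked0.
  by apply: linkedS uv' _ Vv; case/adjacent_delete: uv.
apply: (linkedS uv') => //; apply/adjacent_delete; split=> //.
  by have [] := linked_r uv'.
by case: Vv.
Qed.

Lemma connected_delete D W : connected (delete_verts D W) <->
  forall x y, (verts D `\` W) x -> (verts D `\` W) y ->
    linked (adjacent D) (verts D `\` W) x y.
Proof.
rewrite connectedP; split=> H x y Vx Vy; apply/linked_delete; exact: H.
Qed.

End Paths.

(** * Ends and cuts with finite boundary *)

Section Ray.
Variables (T : Type) (e : T -> T -> Prop).
Hypothesis e_fin : forall x, finite_set [set y | e x y].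
Variables (A0 : set T) (x0 : T).
Hypothesis x0_inf : infinite_set [set y | linked e A0 x0 y].

Let ray_next (p : set T * T) : infinite_set [set y | linked e p.1 p.2 y] ->
  exists z, e p.2 z /\ infinite_set [set y | linked e (p.1 `\` [set p.2]) z y].
Proof.
move=> pinf; apply: contrapT => nz; apply: pinf.
apply: (@sub_finite_set _ _ ([set p.2] `|` \bigcup_(z in [set z | e p.2 z])
  [set y | linked e (p.1 `\` [set p.2]) z y])).
  move=> y py; have [->|py'] := pselect (y = p.2); [by left|right].
  by have [z pz zy] := linked_first py (nesym py'); exists z.
rewrite finite_setU; split; first exact: finite_set1.
apply: bigcup_finite; first exact: e_fin.
by move=> z pz; apply: contrapT => zi; apply: nz; exists z.
Qed.

Let state := {p : set T * T | infinite_set [set y | linked e p.1 p.2 y]}.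

Let succ (s : state) : state :=
  let z := cid (ray_next (svalP s)) in
  exist _ ((sval s).1 `\` [set (sval s).2], sval z) (svalP z).2.

Let st n : state := iter n succ (exist _ (A0, x0) x0_inf).

(** The König argument: among the finitely many components left after deleting
    the current vertex, one that is adjacent to it is again infinite. *)
Lemma ray_exists : exists f : nat -> T,
  [/\ forall i, A0 (f i), injective f & forall i, e (f i) (f i.+1)].
Proof.
pose f n := (sval (st n)).2; pose A n := (sval (st n)).1.
have AS n : A n.+1 = A n `\` [set f n] by [].
have Asub m n : (m <= n)%N -> A n `<=` A m.
  elim: n => [|n IH]; first by rewrite leqn0 => /eqP->.
  rewrite leq_eqVlt => /orP[/eqP->//|]; rewrite ltnS => /IH h.
  by rewrite AS => y [/h].
have Af n : A n (f n).
  have /infinite_setN0[y] := svalP (st n); exact: linked_l.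
have fneq m n : (m < n)%N -> f m <> f n.
  by move=> /Asub/(_ _ (Af n)); rewrite AS => -[_ /= h] E; apply: h.
exists f; split=> [i|m n fmn|i].
- exact: Asub (leq0n i) _ (Af i).
- by case: (ltngtP m n) => // /fneq; rewrite fmn.
- by rewrite /f /=; case: cid => z [].
Qed.

End Ray.

Section OneEnd.
Variables (T : Type) (L : digraph T).
Hypothesis L_fin : forall x, finite_set [set y | adjacent L x y].
Hypothesis L_conn : connected L.
Hypothesis L_end : at_most_one_end L.

Definition frontier (W : set T) : set T :=
  [set x | W x /\ exists2 y, adjacent L x y & ~ W y].

(** The components of [W] are finitely many, since each of them reaches the
    frontier of [W]; one of them is infinite and contains a ray. *)
Lemma half_line_in W : infinite_set (verts L `&` W) -> ~ (verts L `<=` W) ->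
  finite_set (frontier W) ->
  exists2 f, half_line L f & forall i, W (f i).
Proof.
move=> Winf LW Ffin.
have [o [Vo nWo]] : exists o, verts L o /\ ~ W o.
  apply: contrapT => no; apply: LW => x Vx; apply: contrapT => nWx.
  by apply: no; exists x.
have [x xinf] : exists x,
    infinite_set [set y | linked (adjacent L) (verts L `&` W) x y].
  apply: contrapT => nx; apply: Winf.
  apply: (@sub_finite_set _ _ (\bigcup_(x in frontier W)
     [set y | linked (adjacent L) (verts L `&` W) x y])).
    move=> y [Vy Wy].
    have [u [v [yu uv Vv nWv]]] :=
      linked_exit ((connectedP L).1 L_conn y o Vy Vo) Wy nWo.
    exists u; last by apply: linked_sym yu; exact: adjacent_sym.
    by split; [have [] := linked_r yu|exists v].
  by apply: bigcup_finite => // z _; apply: contrapT => zi; apply: nx; exists z.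
have [f [fA finj fe]] := ray_exists L_fin xinf.
by exists f => [|i]; [split=> // i|]; have [] := fA i.
Qed.

(** Rays on both sides of [W] would be equivalent, and the infinitely many
    disjoint paths between them would all meet the frontier of [W]. *)
Lemma one_end_cut W : finite_set (frontier W) -> finite_set (frontier (~` W)) ->
  finite_set (verts L `&` W) \/ finite_set (verts L `\` W).
Proof.
move=> FW FCW.
have [?|Winf] := pselect (finite_set (verts L `&` W)); [by left|right].
apply: contrapT => CWinf.
have [f fL fW] : exists2 f, half_line L f & forall i, W (f i).
  apply: half_line_in => // LW; apply: CWinf.
  by apply: sub_finite_set (finite_set0 _) => x [/LW].
have [g gL gW] : exists2 f, half_line L f & forall i, (~` W) (f i).
  apply: half_line_in => // LW; apply: Winf.
  by apply: sub_finite_set (finite_set0 _) => x [/LW].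
have gg : half_line_equiv L g g.
  have [gV ginj _] := gL.
  exists (fun=> 0%N), (fun k _ => g k);
    split=> [k|i j _ _ [x [[a _ <-] [b _ /ginj]]]//].
  split; [split=> // a b|by exists k|by exists k].
  by rewrite !inE /= !ltnS !leqn0 => /eqP-> /eqP->.
have fg : half_line_equiv L f g.
  suff [] : [set h | half_line L h /\ half_line_equiv L f h] g by [].
  suff -> : [set h | half_line L h /\ half_line_equiv L f h] =
            [set h | half_line L h /\ half_line_equiv L g h] by [].
  by apply: L_end; [exists f|exists g].
have [n [p [pP pdisj]]] := fg.
have pF k : exists x, path_verts (n k) (p k) x /\ frontier W x.
  have [[pV pinj pe] [a _ fa] [b _ gb]] := pP k.
  apply: contrapT => nF.
  have pW i : (i <= n k)%N -> W (p k i).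
    elim: i => [|i IH] lin; first by rewrite -fa.
    apply: contrapT => nW; apply: nF; exists (p k i); split.
      by exists i => //=; rewrite ltnS ltnW.
    by split; [apply: IH; exact: ltnW|exists (p k i.+1) => //; exact: pe].
  by have := pW _ (leqnn _); rewrite -gb; exact: gW.
pose b k := sval (cid (pF k)).
have bP k : path_verts (n k) (p k) (b k) /\ frontier W (b k) by rewrite /b;
  case: cid.
have binj : injective b.
  move=> i j bij; apply: pdisj => //; exists (b i); split;
    first by case: (bP i).
  by rewrite bij; case: (bP j).
apply: infinite_nat; apply: (@sub_finite_set _ _ (b @^-1` frontier W)).
  by move=> k _; case: (bP k).
by apply: finite_preimage FW => i j _ _; exact: binj.
Qed.

End OneEnd.

(** * Cardinals of finite sets *)

Section Ncard.
Variable T : Type.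
Implicit Types A B X : set T.

Definition ncard A : nat := #|` fset_set (A : set {classic T})|.

Lemma ncard_le A B : finite_set B -> A `<=` B -> (ncard A <= ncard B)%N.
Proof.
move=> Bfin AB; have Afin := sub_finite_set AB Bfin.
by apply: fsubset_leq_card; rewrite -fset_set_sub.
Qed.

Lemma ncard_sub_eq A B : finite_set B -> A `<=` B -> (ncard B <= ncard A)%N ->
  A = B.
Proof.
move=> Bfin AB BA; have Afin := sub_finite_set AB Bfin.
apply: (@fset_set_inj {classic T}) => //; rewrite ?inE//.
apply/eqP; rewrite eqEfcard BA andbT.
by rewrite -(@fset_set_sub {classic T}).
Qed.

Lemma ncard_lt A B x : finite_set B -> A `<=` B -> B x -> ~ A x ->
  (ncard A < ncard B)%N.
Proof.
move=> Bfin AB Bx nAx; rewrite ltnNge; apply/negP => BA.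
by apply: nAx; rewrite (ncard_sub_eq Bfin AB BA).
Qed.

Lemma ncard_image (g : T -> T) A : injective g -> finite_set A ->
  ncard (g @` A) = ncard A.
Proof.
move=> ginj Afin; rewrite /ncard.
rewrite (@fset_set_image {classic T} {classic T} g A Afin).
by rewrite card_imfset.
Qed.

Lemma ncard_setU A B : finite_set A -> finite_set B ->
  (ncard (A `|` B) <= ncard A + ncard B)%N.
Proof.
by move=> Af Bf; rewrite /ncard (@fset_setU {classic T})// cardfsU leq_subr.
Qed.

Lemma ncard_sum X A : finite_set X -> A `<=` X ->
  ncard A = \sum_(c <- fset_set (X : set {classic T})) `[< A c >].
Proof.
move=> Xfin AX; have Afin := sub_finite_set AX Xfin.
have P : perm_eq (fset_set (A : set {classic T}))
    [seq c <- fset_set (X : set {classic T}) | `[< A c >]].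
  apply: uniq_perm; [exact: fset_uniq|exact/filter_uniq/fset_uniq|].
  move=> c; rewrite mem_filter !in_fset_set//.
  apply/idP/andP => [/set_mem Ac|[/asboolP Ac _]]; last exact: mem_set.
  by split; [exact/asboolP|exact/mem_set/AX].
rewrite /ncard (perm_size P) size_filter -sum1_count big_mkcond.
by apply: eq_bigr => c _; case: ifP.
Qed.

End Ncard.

(** * Separating vertices *)

Section Separators.
Variables (T : Type) (e : T -> T -> Prop).
Hypothesis e_sym : forall x y, e x y -> e y x.
Hypothesis e_irr : forall x, ~ e x x.
Hypothesis e_conn : forall x y, linked e setT x y.
Local Notation same_side := (same_side e).
Local Notation coblock := (coblock e).

(** The end points [x] and [y] separate themselves from each other; counting
    them makes the number of separating vertices one more than a tree
    distance. *)
Definition sep x y : set T := [set c | ~ same_side c x y].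
Definition nsep x y : nat := ncard (sep x y).

Lemma sep_sym x y : sep x y = sep y x.
Proof. by apply/seteqP; split=> c /= nxy xy;
  apply/nxy/(same_side_sym e_sym). Qed.

Lemma sep_l x y : sep x y x.
Proof. by move=> xy; exact: (same_side_neql xy). Qed.

Lemma sep_r x y : sep x y y.
Proof. by move=> xy; exact: (same_side_neqr xy). Qed.

Lemma sep_id x : sep x x = [set x].
Proof.
apply/seteqP; split=> [c cx|_ ->]; last exact: sep_l.
by apply: contrapT => /nesym xc; apply: cx; exact: same_side_refl.
Qed.

Lemma sep_finite x y : finite_set (sep x y).
Proof.
elim: (e_conn x y) => [_|u v _ fxu uv _]; first by rewrite sep_id;
  exact: finite_set1.
have : finite_set (sep x u `|` [set v]).
  by rewrite finite_setU; split=> //; exact: finite_set1.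
apply: sub_finite_set => c xv; apply: contrapT => /not_orP[/contrapT xu /= cv].
apply: xv; apply: (same_side_trans xu); apply: same_side_edge => //;
  last exact: nesym.
exact: same_side_neqr xu.
Qed.

Lemma coblock_sep x y c : coblock x y -> sep x y c -> c = x \/ c = y.
Proof.
move=> xy cxy; apply: contrapT => /not_orP[cx cy]; apply: cxy.
exact: xy.
Qed.

Lemma nsep_id x : nsep x x = 1%N.
Proof. by rewrite /nsep sep_id /ncard (@fset_set1 {classic T}) cardfs1. Qed.

Lemma nsep2 x y : x <> y -> coblock x y -> nsep x y = 2%N.
Proof.
move=> xy sxy; rewrite /nsep.
have -> : sep x y = [set x] `|` [set y].
  apply/seteqP; split=> [c /(coblock_sep sxy)//|c [->|->]];
    [exact: sep_l|exact: sep_r].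
rewrite /ncard (@fset_setU {classic T}) ?(@fset_set1 {classic T}) ?cardfs2//.
by have /eqP/negbTE -> : (x : {classic T}) <> y by [].
Qed.

Lemma nsep3 x y : ~ coblock x y -> (2 < nsep x y)%N.
Proof.
move=> nxy.
have xy : x <> y by move=> xy; apply: nxy; rewrite xy; exact: coblock_refl.
have [c [cx cy nc]] : exists c, [/\ c <> x, c <> y & sep x y c].
  apply: contrapT => nc; apply: nxy => c cx cy; apply: contrapT => cxy.
  by apply: nc; exists c.
have xyc : [set x; y; c] `<=` sep x y.
  by move=> _ [[->|->]|->] //; [exact: sep_l|exact: sep_r].
apply: leq_trans (ncard_le (sep_finite x y) xyc).
rewrite /ncard (@fset_setU {classic T})//.
rewrite (@fset_setU {classic T})// !(@fset_set1 {classic T}).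
rewrite fsetUC cardfsU1 cardfs2 !inE.
have /eqP/negbTE -> : (x : {classic T}) <> y by [].
have /eqP/negbTE -> : (c : {classic T}) <> x by [].
by have /eqP/negbTE -> : (c : {classic T}) <> y by [].
Qed.

(** Deleting [c] splits the four points along the pairing [xy|zw]; one of the two
    pairs may be split further. *)
Definition crosses c x y z w := (same_side c x y \/ same_side c z w) /\
  [/\ ~ same_side c x z, ~ same_side c x w,
    ~ same_side c y z & ~ same_side c y w].

Lemma crosses_lt c x y z w :
  (`[<sep x y c>] + `[<sep z w c>] < `[<sep x z c>] + `[<sep y w c>])%N ->
  crosses c x y z w.
Proof.
rewrite /sep /crosses /=.
have t := @same_side_trans _ e c; have s := @same_side_sym _ e e_sym c.
have t1 := t y x z; have t2 := t x y z; have t3 := t z x y.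
have u1 := t y x w; have u2 := t x y w; have u3 := t w x y.
have v1 := t z x w; have v2 := t x z w; have v3 := t w x z.
have w1 := t z y w; have w2 := t y z w; have w3 := t w y z.
have := s x y; have := s x z; have := s x w.
have := s y x; have := s y z; have := s y w.
have := s z x; have := s z y; have := s z w.
have := s w x; have := s w y; have := s w z.
rewrite !asbool_neg; do 4!case: asboolP; move=> ? ? ? ? //= *;
  (split; last split); tauto.
Qed.

(** Two different pairings cannot both be realised: of the two sides of [c], one
    does not contain [d], and its points are joined off [d]. *)
Lemma crosses_incompatible c d x y z w :
  crosses c x y z w -> crosses d x w z y -> False.
Proof.
move=> [c1 [cxz cxw cyz cyw]] [_ [dxz dxy dwz dwy]].
have [cd|cd] := pselect (c = d).
  by subst d; case: c1 => // /(same_side_sym e_sym).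
have ex p : ~ same_side c p d -> same_side d p c by exact: same_side_exchange.
have join p q : same_side d p c -> same_side d q c -> same_side d p q.
  by move=> pc qc; apply: same_side_trans pc (same_side_sym e_sym qc).
have away q p : ~ same_side c q p -> same_side c q d -> same_side d p c.
  by move=> qp qd; apply: ex => pd;
    apply/qp/(same_side_trans qd)/(same_side_sym e_sym).
case: c1 => [xy|zw].
  have [xd|xd] := pselect (same_side c x d).
    exact: dwz (join _ _ (away x w cxw xd) (away x z cxz xd)).
  by apply: dxy; apply: join; apply: ex => // yd;
    exact: xd (same_side_trans xy yd).
have [zd|zd] := pselect (same_side c z d).
  apply: dxy; apply: join; apply: (away z) => // h.
    exact: cxz (same_side_sym e_sym h).
  exact: cyz (same_side_sym e_sym h).
by apply: dwz; apply: join; apply: ex => // wd;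
  exact: zd (same_side_trans zw wd).
Qed.

(** If both inequalities fail, they fail at some vertices [c] and [d]
    individually, and these split the four points along different pairings. *)
Lemma four_point x y z w :
  (nsep x z + nsep y w <= nsep x y + nsep z w)%N \/
  (nsep x z + nsep y w <= nsep x w + nsep z y)%N.
Proof.
pose X := sep x y `|` sep z w `|` sep x z `|` sep y w `|` sep x w `|` sep z y.
have Xfin : finite_set X by rewrite !finite_setU; do ?split; exact: sep_finite.
rewrite /nsep !(@ncard_sum _ X)//; try by move=> ? ?; rewrite /X /=; tauto.
rewrite -!big_split /=.
apply: contrapT => /not_orP[/negP h1 /negP h2].
have [c /crosses_lt cP] : exists c,
    (`[<sep x y c>] + `[<sep z w c>] < `[<sep x z c>] + `[<sep y w c>])%N.
  apply: contrapT => nc; move: h1; apply/negP; rewrite negbK.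
  apply: leq_sum => ? _; rewrite leqNgt; apply/negP => lt.
  by apply: nc; eexists; exact: lt.
have [d /crosses_lt dP] : exists c,
    (`[<sep x w c>] + `[<sep z y c>] < `[<sep x z c>] + `[<sep w y c>])%N.
  apply: contrapT => nc; move: h2; apply/negP; rewrite negbK.
  apply: leq_sum => ? _; rewrite leqNgt; apply/negP => lt.
  by apply: nc; eexists; rewrite (sep_sym w y); exact: lt.
exact: crosses_incompatible cP dP.
Qed.

End Separators.

Lemma sep_act T (G : set (T -> T)) e g x y : permutation_group G ->
  cut_orbital G e -> G g -> sep e (g x) (g y) = g @` sep e x y.
Proof.
move=> G_group eG Gg; have [h [Gh gh hg]] := group_inv G_group Gg.
apply/seteqP; split=> [c|_ [c cxy <-]].
  rewrite -(hg c) /sep /= (same_side_actE G_group eG _ _ _ Gg) => cxy.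
  by exists (h c).
by rewrite /sep /= (same_side_actE G_group eG _ _ _ Gg).
Qed.

Lemma nsep_act T (G : set (T -> T)) e g x y : permutation_group G ->
  cut_orbital G e -> G g -> nsep e (g x) (g y) = nsep e x y.
Proof.
move=> G_group eG Gg; rewrite /nsep (sep_act _ _ G_group eG Gg) ncard_image//.
  exact: group_inj G_group _ Gg.
by apply: sep_finite; exact: (co_conn eG).
Qed.

(** * Comparing two graphs *)

(** The form in which the number of ends of a block is used: a finite set of
    edges does not cut it into two infinite parts. *)
Definition cuts_one_sided T (e : T -> T -> Prop) (B : set T) : Prop :=
  forall W : set T,
    finite_set [set x | [/\ B x, W x & exists y, [/\ B y, e x y & ~ W y]]] ->
    finite_set [set x | [/\ B x, ~ W x & exists y, [/\ B y, e x y & W y]]] ->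
    finite_set (B `&` W) \/ finite_set (B `\` W).

Section TwoGraphs.
Variables (T : Type) (G : set (T -> T)) (e1 e2 : T -> T -> Prop).
Hypothesis G_group : permutation_group G.
Hypothesis G_prim : primitive_group G.
Hypothesis G_sub : no_infinite_subdegree G.
Hypothesis eG1 : cut_orbital G e1.
Hypothesis eG2 : cut_orbital G e2.
Hypothesis e1_ends : forall B, block e1 B -> cuts_one_sided e1 B.

Let e1_sym := co_sym eG1.
Let e1_conn := co_conn eG1.
Let e2_sym := co_sym eG2.
Let e2_irr := co_irr eG2.
Let e2_conn := co_conn eG2.
Local Notation same_side := (same_side e2).
Local Notation sep := (sep e2).
Local Notation nsep := (nsep e2).

Lemma translates_finite a c d :
  finite_set [set g a | g in [set g | G g /\ g d = c]].
Proof.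
have [k Gk kd] := G_prim.1 d c.
apply: sub_finite_set (G_sub c (k a)) => _ [g [Gg gd] <-].
have [h [Gh kh hk]] := group_inv G_group Gk.
exists (g \o h); last by rewrite /= kh.
by split; [exact: (group_comp G_group)|rewrite /= -kd kh gd].
Qed.

(** All edges [x y] are translates of one, for which [sep x y] is finite, and
    the translations taking a given vertex to [c] move any vertex to finitely
    many places only. *)
Lemma cut_edges_finite c : finite_set [set x | exists2 y, e1 x y & sep x y c].
Proof.
have [a [b [_ abP]]] := co_arc eG1.
apply: (@sub_finite_set _ _ (\bigcup_(d in sep a b)
  ([set g a | g in [set g | G g /\ g d = c]] `|`
   [set g b | g in [set g | G g /\ g d = c]]))).
  move=> x [y xy cxy]; have [g Gg gab] := abP _ _ xy.
  have : (g @` sep a b) c.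
    rewrite -(sep_act _ _ G_group eG2 Gg).
    by case: gab => -[<- <-] //; rewrite sep_sym.
  move=> [d abd gd]; exists d => //.
  by case: gab => -[E1 E2]; [left|right]; exists g.
apply: bigcup_finite; first exact: sep_finite.
by move=> d _; rewrite finite_setU; split; exact: translates_finite.
Qed.

Section InfiniteBlock.
Variable B : set T.
Hypothesis B_block : block e1 B.
Hypothesis B_inf : infinite_set B.

(** The components off [c] are finitely many, each containing a neighbour of
    [c], and each meets [B] in a set with finite frontier. *)
Lemma main_class c : exists n,
  infinite_set (B `&` [set x | same_side c n x]) /\
  finite_set (B `\` [set x | same_side c n x]).
Proof.
have [n ninf] : exists n, infinite_set (B `&` [set x | same_side c n x]).
  apply: contrapT => nn; apply: B_inf.
  apply: (@sub_finite_set _ _ ([set c] `|`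
    \bigcup_(n in [set n | e2 c n]) (B `&` [set x | same_side c n x]))).
    move=> x Bx; have [->|xc] := pselect (x = c); [by left|right].
    have [n cn nx] := linked_first (e2_conn c x) (nesym xc).
    by exists n => //; split=> //; apply: linked_sub nx => v -[].
  rewrite finite_setU; split; first exact: finite_set1.
  apply: bigcup_finite; first exact: (co_fin eG2).
  by move=> n _; apply: contrapT => ninf; apply: nn; exists n.
exists n; split=> //.
have [||//|//] := e1_ends B_block (W := [set x | same_side c n x]).
- apply: sub_finite_set (cut_edges_finite c) => x [_ nx [y [_ xy nny]]].
  exists y => // cxy; apply: nny; exact: same_side_trans nx cxy.
- apply: sub_finite_set (cut_edges_finite c) => x [_ nnx [y [_ xy ny]]].
  exists y => // cxy; apply: nnx; apply: same_side_trans ny _;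
    exact: same_side_sym.
Qed.

(** The points of [B] outside the component off [c] that contains almost all of
    [B], expressed without choosing that component, hence equivariantly. *)
Definition small_side c : set T :=
  [set x | B x /\ finite_set (B `&` [set y | same_side c x y])].

Lemma small_side_finite c : finite_set (small_side c).
Proof.
have [n [ninf nfin]] := main_class c.
apply: sub_finite_set nfin => x [Bx xfin]; split=> // nx; apply: ninf.
apply: sub_finite_set xfin => y [By ny]; split=> //.
by apply: same_side_trans ny; exact: same_side_sym.
Qed.

(** A point in the main components off [c] and off [d] at once makes the two
    remainders comparable. *)
Lemma far_point c d : exists r, [/\ B r,
  forall y, B y -> small_side c y <-> ~ same_side c r y &
  forall y, B y -> small_side d y <-> ~ same_side d r y].
Proof.
have [n [ninf nfin]] := main_class c.
have [m [minf mfin]] := main_class d.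
have /infinite_setN0[r [Br nrm]] :
    infinite_set (B `\` ((B `\` [set x | same_side c n x]) `|` (B `\` [set x |
      same_side d m x]))).
  by apply: infinite_setD => //; rewrite finite_setU.
have nr : same_side c n r by apply: contrapT => nr; apply: nrm; left.
have mr : same_side d m r by apply: contrapT => mr; apply: nrm; right.
have side k q y : infinite_set (B `&` [set x | same_side k q x]) ->
    finite_set (B `\` [set x | same_side k q x]) -> same_side k q r -> B y ->
    small_side k y <-> ~ same_side k r y.
  move=> qinf qfin qr By; split=> [[_ yfin] ry|nry].
    apply: qinf; apply: sub_finite_set yfin => z [Bz qz]; split=> //.
    apply: same_side_trans (same_side_sym e2_sym (same_side_trans qr ry)) qz.
  split=> //; apply: sub_finite_set qfin => z [Bz yz]; split=> // qz;
    apply: nry.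
  by apply: same_side_trans (same_side_trans (same_side_sym e2_sym qr) qz)
    (same_side_sym e2_sym yz).
by exists r; split=> // y By; apply: side; eassumption.
Qed.

Lemma small_side_nested c d x : small_side c x -> small_side d x ->
  small_side c `<=` small_side d \/ small_side d `<=` small_side c.
Proof.
move=> cx dx; have [r [Br cP dP]] := far_point c d.
have [Bx _] := cx.
have rx := (cP x Bx).1 cx; have rx' := (dP x Bx).1 dx.
have [->|cd] := pselect (c = d); first by left.
have sub k l : k <> l -> ~ same_side k l r ->
    (forall y, B y -> small_side k y <-> ~ same_side k r y) ->
    (forall y, B y -> small_side l y <-> ~ same_side l r y) ->
    small_side l `<=` small_side k.
  move=> kl nlr kP lP y ly; have [By _] := ly.
  have nry := (lP y By).1 ly.
  have lrk : same_side l r k by apply: same_side_exchange => // rl;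
    apply/nlr/same_side_sym.
  apply/(kP y By) => ry; apply: nlr; apply: same_side_sym => //.
  apply: (same_side_trans ry); apply: same_side_exchange => //;
    first exact: nesym.
  by move=> yk; apply: nry; apply: (same_side_trans lrk); exact: same_side_sym.
have [cdr|cdr] := pselect (same_side c d r); last by right; apply: (sub c d).
have [dcr|dcr] := pselect (same_side d c r); last by left;
  apply: (sub d c) => //; exact: nesym.
exfalso; apply: rx'; apply: (same_side_trans (same_side_sym e2_sym dcr));
  apply: same_side_sym => //.
apply: same_side_exchange => // xd; apply: rx;
  apply: same_side_trans (same_side_sym e2_sym cdr) _.
exact: same_side_sym.
Qed.

Lemma small_side_act g c : G g -> g @` B = B ->
  g @` small_side c = small_side (g c).
Proof.
have sub k d : G k -> k @` B = B -> k @` small_side d `<=` small_side (k d).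
  move=> Gk kB _ [x [Bx xfin] <-]; split; first by rewrite -kB; exists x.
  apply: sub_finite_set (finite_image k xfin) => z [Bz xz].
  have [y By kyz] : (k @` B) z by rewrite kB.
  exists y => //; split=> //=.
  by apply/(same_side_actE G_group eG2 _ _ _ Gk); rewrite kyz.
move=> Gg gB; apply/seteqP; split; first exact: sub.
have [h [Gh gh hg]] := group_inv G_group Gg.
have hB : h @` B = B by rewrite -{1}gB (image_cancel _ gh).
move=> x gcx; exists (h x) => //; rewrite -(gh c); exact: sub.
Qed.

(** Some edge of [B] leaves the remainder, at [u] say.  Move [u] to [x] by the
    stabiliser of [B]: the remainder goes to one that also contains [x], hence
    is nested with the first, and equal to it as both have the same number of
    elements. *)
Lemma small_side_near c x : small_side c x -> exists2 y, e1 x y & sep x y c.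
Proof.
move=> cx; have [r [Br cP _]] := far_point c c.
have [Bx _] := cx.
have nr : ~ small_side c r.
  move=> cr; have [/(_ cr) nrr _] := cP r Br.
  have rc : r = c.
    by apply: contrapT => rc; apply: nrr; exact: same_side_refl.
  have [y [By ny]] : exists y, B y /\ ~ small_side c y.
    apply: contrapT => nn; apply: B_inf.
    apply: sub_finite_set (small_side_finite c) => y By; apply: contrapT => ny.
    by apply: nn; exists y.
  by apply: ny; apply/(cP y By) => ry; exact: (same_side_neql ry rc).
have xr := linked_block e1_sym B_block Bx Br (e1_conn x r).
have [u [v [xu uv [_ Bv] ncv]]] := linked_exit xr cx nr.
have cu : small_side c u by have [] := linked_r xu.
have [Bu _] := cu.
have [h [Gh hB hu]] := block_setwise_transitive G_group G_prim eG1 B_block Bu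
  Bx.
have hP := small_side_act c Gh hB.
have hcx : small_side (h c) x by rewrite -hP -hu; exists u.
have cfin := small_side_finite c.
have card : ncard (small_side (h c)) = ncard (small_side c).
  by rewrite -hP ncard_image//; exact: (group_inj G_group).
have E : small_side (h c) = small_side c.
  have [sub|sub] := small_side_nested hcx cx.
    by apply: ncard_sub_eq; rewrite ?card.
  apply/esym; apply: ncard_sub_eq; rewrite ?card//.
  exact: small_side_finite.
have Bhv : B (h v) by rewrite -hB; exists v.
have nhv : ~ small_side c (h v).
  rewrite -E -hP => -[w cw /(group_inj G_group Gh) wv].
  by apply: ncv; rewrite -wv.
exists (h v); first by rewrite -hu; exact: (co_inv eG1).
move=> xhv; have rhv : same_side c r (h v) by apply: contrapT => /(cP _ Bhv).
by apply: (cP x Bx).1 cx _; apply: same_side_trans rhv (same_side_sym e2_sym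
  xhv).
Qed.

(** A vertex that separates [x] from [y] has [x] or [y] in its remainder, so by
    [small_side_near] it separates [x] or [y] from one of its neighbours. *)
Lemma nsep_bounded_infinite : exists N, forall x y,
  B x -> B y -> (nsep x y <= N)%N.
Proof.
pose Z x := \bigcup_(y in [set y | e1 x y]) sep x y.
have Zfin x : finite_set (Z x).
  by apply: bigcup_finite; [exact: (co_fin eG1)|move=> y _; exact: sep_finite].
have Zact g x : G g -> Z (g x) = g @` Z x.
  move=> Gg; have [h [Gh gh hg]] := group_inv G_group Gg.
  rewrite image_bigcup; apply/seteqP; split=> [c [y gxy]|c [y xy]].
    move=> cP; exists (h y).
      by rewrite /= -(gh x); exact: (co_inv eG1).
    by rewrite -(sep_act _ _ G_group eG2 Gg) hg.
  rewrite -(sep_act _ _ G_group eG2 Gg) => cP; exists (g y) => //.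
  exact: (co_inv eG1).
have [x0 [y0 [_ Bx0 _]]] := block_edge eG1 B_block.
have Zcard x : ncard (Z x) = ncard (Z x0).
  have [g Gg <-] := G_prim.1 x0 x; rewrite Zact// ncard_image//.
  exact: (group_inj G_group).
exists (ncard (Z x0) + ncard (Z x0))%N => x y Bx By.
have sub : sep x y `<=` Z x `|` Z y.
  move=> c cxy; have [r [Br cP _]] := far_point c c.
  have [rx|rx] := pselect (same_side c r x); [right|left].
    have [|w yw cyw] := @small_side_near c y; last by exists w.
    apply/(cP y By) => ry; apply: cxy;
      exact: same_side_trans (same_side_sym e2_sym rx) ry.
  have [|w xw cxw] := @small_side_near c x; last by exists w.
  exact/(cP x Bx).
have Ufin : finite_set (Z x `|` Z y) by rewrite finite_setU.
apply: leq_trans (ncard_le Ufin sub) _;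
  apply: leq_trans (ncard_setU _ _) _ => //.
by rewrite !Zcard.
Qed.

End InfiniteBlock.

Lemma nsep_bounded : exists N, forall x y, coblock e1 x y -> (nsep x y <= N)%N.
Proof.
have [x0 [y0 [z0 [e10 _ _]]]] := co_cut eG1.
have hB := block_blockof (edge_neq eG1 e10) (coblock_edge e10).
set B := block_of e1 _ _ in hB.
have [N NP] : exists N, forall x y, B x -> B y -> (nsep x y <= N)%N.
  have [Bfin|Binf] := pselect (finite_set B); last exact: nsep_bounded_infinite.
  pose U := \bigcup_(x in B) \bigcup_(y in B) sep x y.
  have Ufin : finite_set U.
    by do 2?[apply: bigcup_finite => // ? _]; exact: sep_finite.
  exists (ncard U) => x y Bx By; apply: ncard_le => // c cxy.
  by exists x => //; exists y.
exists N.+1 => x y sxy; have [<-|xy] := pselect (x = y).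
  by rewrite nsep_id.
have [g Gg gC] := block_trans G_group eG1 (block_blockof xy sxy) hB.
have Bgx : B (g x) by rewrite -gC; exists x => //; exact: block_of_l.
have Bgy : B (g y) by rewrite -gC; exists y => //; exact: block_of_r.
by rewrite -(nsep_act _ _ G_group eG2 Gg); apply: leqW; exact: NP.
Qed.

(** If [x], [y], [z] lie in a block and [z] is at the maximal distance [D] from
    [x] while both are closer to [y], take [w] at distance [D] from [y]: the sum
    [2 * D] would violate the four-point condition. *)
Lemma nsep_constant : ~ (forall x y, coblock e1 x y -> coblock e2 x y) ->
  exists2 D, (2 < D)%N & forall x y, x <> y -> coblock e1 x y -> nsep x y = D.
Proof.
move=> nsub.
have [x1 [y1 [xy1 nxy1]]] : exists x y, coblock e1 x y /\ ~ coblock e2 x y.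
  apply: contrapT => nn; apply: nsub => x y xy; apply: contrapT => nxy.
  by apply: nn; exists x, y.
have [N NP] := nsep_bounded.
pose Q n := `[< exists x y, coblock e1 x y /\ nsep x y = n >].
have Qex : exists n, Q n by exists (nsep x1 y1); apply/asboolP; exists x1, y1.
have QN n : Q n -> (n <= N)%N by move=> /asboolP[x [y [xy <-]]]; exact: NP.
case: (ex_maxnP Qex QN) => D /asboolP[xm [ym [xym Dm]]] Dmax.
have leD x y : coblock e1 x y -> (nsep x y <= D)%N.
  by move=> xy; apply: Dmax; apply/asboolP; exists x, y.
have D3 : (2 < D)%N.
  by apply: leq_trans (leD _ _ xy1); apply: nsep3.
have xm_ym : xm <> ym by move=> E; move: D3; rewrite -Dm E nsep_id.
have hBm := block_blockof xm_ym xym.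
have attain B x : block e1 B -> B x -> exists2 w, B w & nsep x w = D.
  move=> hB Bx; have [g Gg gB] := block_trans G_group eG1 hBm hB.
  have Bgx : B (g xm) by rewrite -gB; exists xm => //; exact: block_of_l.
  have Bgy : B (g ym) by rewrite -gB; exists ym => //; exact: block_of_r.
  have [h [Gh hhB hx]] := block_setwise_transitive G_group G_prim eG1 hB Bgx Bx.
  exists (h (g ym)); first by rewrite -hhB; exists (g ym).
  by rewrite -hx (nsep_act _ _ G_group eG2 Gh) (nsep_act _ _ G_group eG2 Gg).
exists D => //.
pose R x y := coblock e1 x y /\ (nsep x y < D)%N.
have [|||||Rtriv|Rtot] := @dichotomy _ G e1 G_prim eG1 R.
- move=> x; split; first exact: coblock_refl.
  by rewrite nsep_id; exact: ltnW.
- move=> x y [xy lt]; split; first exact: coblock_sym.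
  by rewrite /nsep sep_sym.
- by move=> x y [].
- move=> x y z [xy ltxy] [yz ltyz] xz; split=> //.
  rewrite ltn_neqAle leD// andbT; apply/eqP => Dxz.
  have [E|nxy] := pselect (x = y); first by rewrite E in Dxz;
    rewrite Dxz ltnn in ltyz.
  have hB := block_blockof nxy xy.
  have Bx := block_of_l e1_sym xy; have By := block_of_r xy.
  have Bz : block_of e1 x y z by split.
  have [w Bw Dyw] := attain _ y hB By.
  have leB u v : block_of e1 x y u -> block_of e1 x y v -> (nsep u v <= D)%N.
    by move=> Bu Bv; apply/leD/(block_coblock e1_sym hB).
  have ltzy : (nsep z y < D)%N by rewrite /nsep sep_sym.
  have [] := four_point e2_sym e2_conn x y z w; rewrite Dxz Dyw leqNgt.
    by rewrite -addSn leq_add// leB.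
  by rewrite -addnS leq_add// leB.
- move=> g x y Gg [xy lt]; split; first exact: (coblock_act G_group eG1).
  by rewrite (nsep_act _ _ G_group eG2 Gg).
- move=> x y nxy xy; apply/eqP; rewrite eqn_leq leD//= leqNgt; apply/negP => lt.
  by apply: nxy; apply: Rtriv.
- by have [_] := Rtot _ _ xym; rewrite Dm ltnn.
Qed.

Section Constant.
Variable D : nat.
Hypothesis D3 : (2 < D)%N.
Hypothesis nsepD : forall x y, x <> y -> coblock e1 x y -> nsep x y = D.

Lemma not_coblock2 x y : x <> y -> coblock e1 x y -> ~ coblock e2 x y.
Proof.
by move=> xy sxy /(nsep2 xy) E; move: D3; rewrite -(nsepD xy sxy) E.
Qed.

(** Otherwise [c] would separate [z] from [y] without separating [x] from [z],
    and then all vertices separating [x] from [z], with [x] replaced by [c], and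
    [y] in addition, would separate [z] from [y]. *)
Lemma nearest_constant B x y z c : block e1 B -> B x -> B y -> B z -> y <> x ->
  z <> x -> nearest e2 x y c -> nearest e2 x z c.
Proof.
move=> hB Bx By Bz yx zx [cx sxc ncxy]; split=> // cxz.
have s1 u v : B u -> B v -> coblock e1 u v by exact: block_coblock.
have cy : c <> y by move=> E; apply: (not_coblock2 (nesym yx) (s1 _ _ Bx By));
  rewrite -E.
have nczy : ~ same_side c z y by move=> zy; apply: ncxy;
  exact: same_side_trans cxz zy.
have zy : z <> y by move=> E; apply: ncxy; rewrite -E.
(* Besides x, what separates x from z lies beyond c, so it separates z from y. *)
have cfar u : sep x z u -> u <> x -> sep z y u.
  move=> xzu ux zyu.
  have uc : u <> c by move=> E; apply: xzu; rewrite E.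
  have xcu : same_side u x c by apply: sxc => //.
  have nuzc : ~ same_side u z c.
    by move=> zc; apply: xzu; apply: same_side_trans xcu _;
      exact: same_side_sym.
  have czu : same_side c z u by exact: same_side_exchange.
  have nyu : ~ same_side c y u.
    move=> yu; apply: nczy; apply: same_side_trans czu _; exact: same_side_sym.
  have uyc : same_side u y c by apply: same_side_exchange => //; exact: nesym.
  by apply: nuzc; exact: same_side_trans zyu uyc.
have ynot : ~ sep x z y.
  move=> xzy; have zyy := cfar y xzy yx.
  have ycx : same_side y x c by apply: sxc => //; exact: nesym.
  have nyzc : ~ same_side y z c.
    move=> zc; apply: xzy; apply: same_side_trans ycx _; exact: same_side_sym.
  by apply: nczy; apply: same_side_exchange => //; exact: nesym.
have xzc : ~ sep x z c by move=> h; apply: h.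
have fin := sep_finite e2_conn z y.
have sub : (sep x z `\` [set x]) `|` ([set c] `|` [set y]) `<=` sep z y.
  move=> u [[xzu ux]|[->|->]]; [exact: cfar|exact: nczy|exact: sep_r].
have xzfin := sep_finite e2_conn x z.
pose A := sep x z `\` [set x].
have Afin : finite_set A by exact: finite_setD.
have ltc : (ncard A < ncard (A `|` [set c]))%N.
  apply: (@ncard_lt _ _ _ c); [|by left|by right|by case=> /xzc].
  by rewrite finite_setU; split=> //; exact: finite_set1.
have lty : (ncard (A `|` [set c]) < ncard (sep z y))%N.
  apply: (@ncard_lt _ _ _ y) => //; [by move=> u Au; apply: sub; case: Au;
    [left|right; left]|exact: sep_r|].
  by case=> [[/ynot]|/esym].
have leA : (ncard (sep x z) <= (ncard A).+1)%N.
  rewrite -addn1 -(_ : ncard [set x] = 1%N); last first.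
    by rewrite /ncard (@fset_set1 {classic T}) cardfs1.
  apply: leq_trans (ncard_setU Afin (finite_set1 x)).
  apply: ncard_le; first by rewrite finite_setU; split=> //; exact: finite_set1.
  by move=> u xzu; have [->|ux] := pselect (u = x); [right|left].
move: (leq_ltn_trans leA (leq_ltn_trans ltc lty)).
have -> : ncard (sep x z) = D by apply: nsepD (s1 _ _ Bx Bz); exact: nesym.
have -> : ncard (sep z y) = D by apply: nsepD (s1 _ _ Bz By).
by rewrite ltnn.
Qed.

(** The stabiliser of a point [x] of a block [B] of the first graph fixes the
    nearest cut vertex [c] of the second, hence everything that is defined from
    [x], [B] and [c] in the first graph. *)
Lemma constant_absurd : False.
Proof.
have [y [x [_ [xy _ _]]]] := co_cut eG1.
have nxy := edge_neq eG1 xy; have sxy := coblock_edge xy.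
have hB := block_blockof nxy sxy; set B := block_of e1 x y in hB.
have Bx : B x := block_of_l e1_sym sxy; have By : B y := block_of_r sxy.
have [c xyc] := nearest_exists e2_sym e2_irr e2_conn nxy.
have [cx _ _] := xyc.
have fixc g : G g -> g @` B = B -> g x = x -> g c = c.
  move=> Gg gB gx.
  have Bgy : B (g y) by rewrite -gB; exists y.
  have gyx : g y <> x.
    by move=> E; apply: nxy; apply: (group_inj G_group Gg); rewrite gx E.
  have c1 := nearest_constant hB Bx By Bgy (nesym nxy) gyx xyc.
  have := nearest_act G_group eG2 Gg xyc; rewrite gx => c2.
  exact: (nearest_unique e2_sym e2_conn c2 c1).
(* The vertex p of B through which c is reached in the first graph. *)
have [p cp] := gate_exists e1_sym e1_conn c hB.
have fixp g : G g -> g @` B = B -> g x = x -> g p = p.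
  move=> Gg gB gx; have := gate_act G_group eG1 Gg cp.
  rewrite gB (fixc g Gg gB gx) => cgp.
  exact: (gate_unique e1_sym e1_conn hB cgp cp).
have Bp : B p by case: cp.
have [px|px] := pselect (p = x); last first.
  exact: (no_fixed_point G_group G_prim eG1 hB Bx Bp px fixp).
subst p.
(* Here p = x: the same argument applies to the block C at x that leads to c. *)
have [z xcz] := nearest_exists e1_sym (co_irr eG1) e1_conn (nesym cx).
have [zx sxz nzxc] := xcz.
have fixz g : G g -> g @` B = B -> g x = x -> g z = z.
  move=> Gg gB gx; have := nearest_act G_group eG1 Gg xcz.
  rewrite gx (fixc g Gg gB gx) => h;
    exact: (nearest_unique e1_sym e1_conn h xcz).
have hC := block_blockof (nesym zx) sxz; set C := block_of e1 x z in hC.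
have Cx : C x := block_of_l e1_sym sxz; have Cz : C z := block_of_r sxz.
have BC g : G g -> g x = x -> g @` B = B -> g @` C = C.
  move=> Gg gx gB; apply: (block_act_eq G_group eG1 Gg hC hC Cx Cz (nesym zx)).
    by rewrite gx.
  by rewrite fixz.
have CB := stabiliser_inclusion_sym G_group G_prim eG1 hB hC Bx Cx BC.
apply: (no_fixed_point G_group G_prim eG1 hC Cx Cz zx) => g Gg gC gx.
by apply: fixz => //; exact: CB.
Qed.

End Constant.

Lemma coblock_sub x y : coblock e1 x y -> coblock e2 x y.
Proof.
move: x y; apply: contrapT => /nsep_constant[D D3 nsepD].
exact: constant_absurd D3 nsepD.
Qed.

End TwoGraphs.

(** * Lobes are the digraphs induced on blocks *)

Lemma digraph_eq T (D1 D2 : digraph T) :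
  verts D1 = verts D2 -> arcs D1 = arcs D2 -> D1 = D2.
Proof.
case: D1 D2 => [V1 A1 h1 l1] [V2 A2 h2 l2] /= EV EA; subst V2 A2.
by congr Digraph; exact: Prop_irrelevance.
Qed.

Definition induced T (D : digraph T) (B : set T) := delete_verts D (~` B).

Section Lobes.
Variables (T : Type) (D : digraph T).
Hypothesis D_verts : verts D = setT.
Hypothesis D_conn : forall x y, linked (adjacent D) setT x y.
Local Notation e := (adjacent D).
Local Notation e_sym := (@adjacent_sym T D).
Implicit Types (L : digraph T) (A B : set T).

Lemma induced_verts B : verts (induced D B) = B.
Proof. by rewrite /= D_verts setTD setCK. Qed.

Lemma adjacent_induced B x y :
  adjacent (induced D B) x y <-> [/\ e x y, B x & B y].
Proof.
rewrite adjacent_delete; split=> -[xy]; last by split=> //; apply.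
by move=> /contrapT ? /contrapT ?.
Qed.

Lemma linked_induced B A x y : A `<=` B -> linked e A x y ->
  linked (adjacent (induced D B)) A x y.
Proof.
move=> AB; elim=> [Ax|u v _ xu uv Av]; first exact: linked0.
apply: (linkedS xu) => //; apply/adjacent_induced; split=> //; apply: AB => //.
exact: linked_r xu.
Qed.

Lemma subdigraph_induced L B : subdigraph L D -> verts L `<=` B ->
  subdigraph L (induced D B).
Proof.
move=> [LV LA] LB; split=> [x Lx|[x y] xy]; first by rewrite induced_verts;
  exact: LB.
have [/= Lx Ly] := arcs_verts xy.
split; first exact: LA.
by split; rewrite D_verts; split=> //; apply; exact: LB.
Qed.

(** A vertex [c] deleted from [D] is either outside [L], or not a cut vertex of
    [L]. *)
Lemma connectivity_gt1_coblock L x y : subdigraph L D -> connectivity_gt1 L ->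
  verts L x -> verts L y -> coblock e x y.
Proof.
move=> [LV LA] [_ Lconn Lcut] Lx Ly c cx cy.
have LD u v : adjacent L u v -> adjacent D u v by case=> /LA; [left|right].
have [Lc|nLc] := pselect (verts L c).
  have /connected_delete Lc' : connected (delete_verts L [set c]).
    by apply: contrapT => nc; apply: (Lcut c).
  apply: (@linked_map _ _ _ id (verts L `\` [set c])); first exact: LD.
    by move=> u [].
  by apply: Lc'; split=> //; exact: nesym.
apply: (@linked_map _ _ _ id (verts L)); first exact: LD.
  by move=> u Lu uc; apply: nLc; rewrite -uc.
exact: (connectedP L).1.
Qed.

Lemma block_connectivity_gt1 B : block e B -> connectivity_gt1 (induced D B).
Proof.
move=> hB; have [x [y [xy sxy Bxy]]] := hB.
split.
- exists x, y; rewrite induced_verts Bxy.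
  by split; [exact: (block_of_l e_sym sxy)|exact: block_of_r|].
- apply/connectedP => u v; rewrite induced_verts => Bu Bv.
  apply: linked_induced => //.
  by have := linked_block e_sym hB Bu Bv (D_conn u v); rewrite setTI.
- move=> c [Bc]; apply; apply/connected_delete => u v.
  rewrite induced_verts => -[Bu uc] [Bv vc].
  apply: linked_induced; first by move=> ? [].
  have [<-|uv] := pselect (u = v); first by apply: linked0.
  have cuv : same_side e c u v.
    by apply: (block_coblock e_sym hB) => //; exact: nesym.
  by apply: linked_sub (linked_block e_sym hB Bu Bv cuv) => w [].
Qed.

(** Walks between two vertices of a block can be kept inside it, also off a
    given vertex; and by [connectivity_gt1_coblock] nothing larger than a block
    has connectivity greater than one. *)
Lemma block_lobe B : block e B -> lobe D (induced D B).
Proof.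
move=> hB; split; [|exact: block_connectivity_gt1|].
  split; first by rewrite D_verts.
  by move=> a [].
move=> L' sL' cL' BL'; have [x [y [xy sxy Bxy]]] := hB.
have VL' z : B z -> verts L' z by move=> Bz; apply: BL'.1;
  rewrite induced_verts.
have L'B : verts L' `<=` B.
  have Lx : verts L' x by apply: VL'; rewrite Bxy;
    exact: (block_of_l e_sym sxy).
  have Ly : verts L' y by apply: VL'; rewrite Bxy; exact: block_of_r.
  by move=> z Lz; rewrite Bxy; split; apply: (connectivity_gt1_coblock sL' cL').
have [h1 h2] := subdigraph_induced sL' L'B; have [h3 h4] := BL'.
by apply: digraph_eq; apply/seteqP; split.
Qed.

(** The lobe is contained in the digraph induced on the block of two of its
    vertices, which is connected enough for maximality to apply. *)
Lemma lobe_block L : lobe D L -> block e (verts L) /\ L = induced D (verts L).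
Proof.
move=> [sL cL Lmax]; have [[x [y [Lx Ly xy]]] _ _] := cL.
have sxy := connectivity_gt1_coblock sL cL Lx Ly.
have hB := block_blockof xy sxy.
have LB : verts L `<=` block_of e x y.
  by move=> z Lz; split; apply: (connectivity_gt1_coblock sL cL).
have [sB cB _] := block_lobe hB.
have E := Lmax _ sB cB (subdigraph_induced sL LB).
by rewrite -E induced_verts.
Qed.

Lemma lobes_at_card x : lobes_at D x #= [set B | block e B /\ B x].
Proof.
have -> : lobes_at D x = induced D @` [set B | block e B /\ B x].
  apply/seteqP; split=> [L [/lobe_block[hL E] Lx]|_ [B [hB Bx] <-]].
    by exists (verts L).
  by split; [exact: block_lobe|rewrite induced_verts].
apply: inj_card_eq => A B _ _ E.
by rewrite -(induced_verts A) E induced_verts.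
Qed.

End Lobes.

Lemma blocks_at_card T (G : set (T -> T)) e x y : permutation_group G ->
  primitive_group G -> cut_orbital G e ->
  [set B | block e B /\ B x] #= [set B | block e B /\ B y].
Proof.
move=> G_group G_prim eG; have [g Gg <-] := G_prim.1 x y.
have [h [Gh gh hg]] := group_inv G_group Gg.
rewrite card_eq_sym.
have -> : [set B | block e B /\ B (g x)] =
    (fun B => g @` B) @` [set B | block e B /\ B x].
  apply/seteqP; split=> [B [hB Bgx]|_ [B [hB Bx] <-]].
    exists (h @` B); last exact: image_cancel.
    by split; [exact: (block_act G_group eG)|exists (g x)].
  by split; [exact: (block_act G_group eG)|exists x].
apply: inj_card_eq => A B _ _ /(congr1 (fun C => h @` C)).
by rewrite !(image_cancel _ gh).
Qed.

Section Canonical.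
Variables (T : Type) (G : set (T -> T)) (D : digraph T).
Hypothesis G_group : permutation_group G.
Hypothesis D_canonical : canonical_orbital_digraph G D.

(** Connectivity one provides the cut vertex required by [co_cut]. *)
Lemma canonical_cut_orbital : verts D = setT /\ cut_orbital G (adjacent D).
Proof.
have [[DV [a [b Aab]]] Dfin [_ Dconn [W [[_ nsep] W1]] _] _] := D_canonical.
have linkD x y : linked (adjacent D) setT x y.
  by rewrite -DV; apply: (connectedP D).1; rewrite // DV.
have act g x y : G g -> arcs D (x, y) -> arcs D (g x, g y).
  rewrite Aab => Gg [k Gk [<- <-]]; exists (g \o k) => //.
  exact: (group_comp G_group).
split=> //; split=> //.
- exact: adjacent_sym.
- exact: adjacent_irr.
- by move=> g x y Gg [xy|xy]; [left|right]; exact: act.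
- exists a, b; split.
    by left; rewrite Aab; exists id => //; exact: (group_id G_group).
  move=> x y [|]; rewrite Aab => -[g Gg [<- <-]]; exists g => //;
    [left|right] => //.
- have [w Ww] : exists w, W = [set w].
    have /pcard_eqP/bijPex[f [ff finj fsurj]] := W1.
    have [w Ww fw] := fsurj 0%N (ltn0Sn 0).
    exists w; apply/seteqP; split=> [v Wv|_ ->//].
    apply: finj; rewrite ?inE//; rewrite fw.
    by have := ff v Wv; rewrite /= ltnS leqn0 => /eqP.
  subst W.
  have [x [y [xw yw nxy]]] : exists x y,
      [/\ x <> w, y <> w & ~ same_side (adjacent D) w x y].
    apply: contrapT => nn; apply: nsep; apply/connected_delete => x y.
    rewrite DV => -[_ xw] [_ yw]; apply: contrapT => nxy; apply: nn.
    exists x, y; split=> // xy; apply: nxy.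
    by apply: linked_sub xy => v.
  have [u wu ux] := linked_first (linkD w x) (nesym xw).
  have [v wv vy] := linked_first (linkD w y) (nesym yw).
  exists u, w, v; split=> // uv; apply: nxy.
  have sub z t : linked (adjacent D) (setT `\` [set w]) z t ->
      same_side (adjacent D) w z t.
    by apply: linked_sub => ? [].
  apply: (same_side_trans (same_side_sym (@adjacent_sym _ D) (sub _ _ ux))).
  exact: same_side_trans uv (sub _ _ vy).
- by move=> x; apply: Dfin; rewrite DV.
Qed.

Lemma canonical_cuts B : block (adjacent D) B -> cuts_one_sided (adjacent D) B.
Proof.
move=> hB W W1 W2.
have [DV eG] := canonical_cut_orbital.
have linkD := co_conn eG.
have BL := block_lobe DV linkD hB.
have [_ _ _ /(_ _ BL) Lend] := D_canonical.
have [_ [_ Lconn _] _] := BL.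
have Lfin x : finite_set [set y | adjacent (induced D B) x y].
  by apply: sub_finite_set (co_fin eG x) => y /adjacent_induced[].
have [|||] := one_end_cut Lfin Lconn Lend (W := W).
- apply: sub_finite_set W1 => x [Wx [y /adjacent_induced[xy Bx By] nWy]].
  by split=> //; exists y.
- apply: sub_finite_set W2 => x [Wx [y /adjacent_induced[xy Bx By] nWy]].
  by split=> //; exists y; split=> //; exact: contrapT.
- by rewrite induced_verts//; left.
- by rewrite induced_verts//; right.
Qed.

End Canonical.

Theorem theorem4p4 (Omega : Type) (G : set (Omega -> Omega))
  (Omega_infinite : infinite_set (@setT Omega))
  (G_group : permutation_group G)
  (G_primitive : primitive_group G)
  (G_subdegrees : no_infinite_subdegree G)
  (Gamma1 Gamma2 : digraph Omega)
  (Gamma1_canonical : canonical_orbital_digraph G Gamma1)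
  (Gamma2_canonical : canonical_orbital_digraph G Gamma2) :
  equivalent_digraphs Gamma1 Gamma2.
Proof.
have [V1 eG1] := canonical_cut_orbital G_group Gamma1_canonical.
have [V2 eG2] := canonical_cut_orbital G_group Gamma2_canonical.
have ends1 := canonical_cuts G_group Gamma1_canonical.
have ends2 := canonical_cuts G_group Gamma2_canonical.
have coE : coblock (adjacent Gamma1) = coblock (adjacent Gamma2).
  apply/funext => x; apply/funext => y; apply/propext.
  split; first exact: (coblock_sub G_group G_primitive G_subdegrees eG1 eG2).
  exact: (coblock_sub G_group G_primitive G_subdegrees eG2 eG1).
have blockE : block (adjacent Gamma1) = block (adjacent Gamma2).
  by rewrite /block /block_of coE.
have card1 := lobes_at_card V1 (co_conn eG1).
have card2 := lobes_at_card V2 (co_conn eG2).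
split; last first.
  move=> m L [/(lobe_block V1 (co_conn eG1))[hL _] Lm].
  exists (induced Gamma2 (verts L)); split; last exact: induced_verts.
  split; first by apply: (block_lobe V2 (co_conn eG2)); rewrite -blockE.
  move=> x _; apply: card_eq_trans (card2 x) _; rewrite -blockE.
  apply: card_eq_trans (Lm x _); last by rewrite V1.
  by rewrite card_eq_sym.
have [x [y [z [yx _ _]]]] := co_cut eG1.
have hB := block_blockof (edge_neq eG1 yx) (coblock_edge yx).
have [m xm] := (finite_setP _).1 (finite_blocks eG1 x).
exists m, (induced Gamma1 (block_of (adjacent Gamma1) y x)); split.
  exact: (block_lobe V1 (co_conn eG1)).
move=> t _; apply: card_eq_trans (card1 t) _; apply: card_eq_trans xm.
exact: (blocks_at_card _ _ G_group).
Qed.
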